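(* Let $d_m$, $m=0,1,2$, be the linear (ideal) weights of the WENO-E scheme, and assume that $g(u)_{xxx}$, i.e. the third derivative of $v(x)=g(u(x))$, is smooth around the big stencil $S_7=\{x_{i-2},\dots,x_{i+4}\}$. Then the nonlinear weights $$\omega_m = \frac{\alpha_m}{\sum_{j=0}^2 \alpha_j}, \qquad \alpha_m = d_m \left( 1+ \frac{\zeta}{\beta_m + \Delta x^2}\right),\qquad m=0,1,2,$$ satisfy $$\omega_m^{\pm}-d_m=\mathcal{O}(\Delta x^3)\quad (\Delta x\to0),\qquad m=0,1,2,$$ even in the presence of critical points where the third and higher derivatives of $v$ vanish. Here $\omega_m^{+}$ are the weights computed at the interface $x_{i+\frac12}$ and $\omega_m^-$ those computed at $x_{i-\frac12}$.
   Context: Grid: uniform with step $\Delta x>0$, $x_j=x_i+(j-i)\Delta x$, $x_{i+\frac12}=x_i+\frac{\Delta x}2$. Write $v(x)=g(u(x))$ and $v_j=v(x_j)$. ''Smooth around the big stencil'' means smooth on an open interval containing the points involved; $\mathcal{O}(\cdot)$ is understood as $\Delta x\to0$ with $x_i$ and $v$ fixed. Let $\lambda\neq0$ be a fixed parameter, $\lambda\in\mathbb{R}$ or $\lambda\in\sqrt{-1}\,\mathbb{R}$, and put $$\Gamma_7=\mathrm{span}\{1,x,x^2,e^{\lambda x},e^{-\lambda x},\cos\lambda x,\sin\lambda x\},\qquad \Gamma_5=\mathrm{span}\{1,x,x^2,e^{\lambda x},e^{-\lambda x}\}.$$ For a function $q$ define the triple average $$(Mq)(x)=\frac1{\Delta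 x^3}\int_{x-\frac{\Delta x}2}^{x+\frac{\Delta x}2}\int_{\eta-\frac{\Delta x}2}^{\eta+\frac{\Delta x}2}\int_{\xi-\frac{\Delta x}2}^{\xi+\frac{\Delta x}2}q(\theta)\,d\theta\,d\xi\,d\eta .$$ Fluxes. Let $q\in\Gamma_7$ be the function with $(Mq)(x_j)=v_j$ for $j=i-2,\dots,i+4$. The coefficients $C_0,\dots,C_6$ (depending only on $\lambda\Delta x$) are defined by $$q(x_{i+\frac32})-2q(x_{i+\frac12})+q(x_{i-\frac12})=\sum_{k=0}^6C_k\,v_{i-2+k}.$$ For $m=0,1,2$ let $S_m=\{x_{i-2+m},\dots,x_{i+2+m}\}$ and let $q_m\in\Gamma_5$ be the function with $(Mq_m)(x_j)=v_j$ for $x_j\in S_m$. The coefficients $C^m_0,\dots,C^m_4$ are defined by $$q_m(x_{i+\frac32})-2q_m(x_{i+\frac12})+q_m(x_{i-\frac12})=\sum_{k=0}^4C^m_k\,v_{i-2+m+k}.$$ (These functions and coefficients are well defined for $\Delta x$ small.) Ideal weights: $$d_0=\frac{C_0}{C^0_0},\qquad d_1=\frac{C_1-d_0C^0_1}{C^1_0},\qquad d_2=\frac{C_2-d_0C^0_2-d_1C^1_1}{C^2_0}.$$ They satisfy $d_0+d_1+d_2=1$ and converge to $\frac4{15},\frac12,\frac7{30}$ respectively as $\Delta x\to0$. Undivided differences at $x_{i+\frac12}$: $$\begin{aligned} \mathcal D_0^3&=\mathcal D_1^3=-v_{i-1}+3v_i-3v_{i+1}+v_{i+2},\\ \mathcal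 D_2^3&=-2v_i+7v_{i+1}-9v_{i+2}+5v_{i+3}-v_{i+4},\\ \mathcal D_m^4&=v_{i-2+m}-4v_{i-1+m}+6v_{i+m}-4v_{i+1+m}+v_{i+2+m},\quad m=0,1,2. \end{aligned}$$ Smoothness indicators: $\beta_m=|\mathcal D_m^3|+|\mathcal D_m^4|$ for $m=0,1,2$, and the global indicator is $\zeta=|\beta_0-\beta_2|$. The weights $\omega_m^+$ are given by the formula for $\omega_m$ with these quantities; the weights $\omega_m^-$ are given by the same formula with every grid index shifted by $-1$. *)

(* Defs.v *)
From Stdlib Require Export Reals ZArith List.
From Coquelicot Require Export Coquelicot.
Export ListNotations.

Open Scope R_scope.

Definition Cexp (z : C) : C := (exp (Re z) * cos (Im z), exp (Re z) * sin (Im z)).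
Definition Ccos (z : C) : C := ((Cexp (Ci * z) + Cexp (- (Ci * z))) / 2)%C.
Definition Csin (z : C) : C := ((Cexp (Ci * z) - Cexp (- (Ci * z))) / (2 * Ci))%C.

(* The real-valued functions in the complex span of B.  Complex coefficients
   treat real and purely imaginary lambda uniformly: for lambda = i * mu the
   basis functions below are complex, but their span is stable under complex
   conjugation, so real data are interpolated by real-valued members. *)
Definition in_span (B : list (R -> C)) (q : R -> R) : Prop :=
  exists a : nat -> C, forall x : R,
    RtoC (q x) =
    sum_n (fun k => (a k * nth k B (fun _ => RtoC 0) x)%C) (length B - 1).

Definition Gamma5 (lambda : C) : list (R -> C) :=
  [ (fun _ : R => RtoC 1);
    (fun x : R => RtoC x);
    (fun x : R => RtoC (x ^ 2));
    (fun x : R => Cexp (lambda * x)%C);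
    (fun x : R => Cexp (- lambda * x)%C) ].

Definition Gamma7 (lambda : C) : list (R -> C) :=
  Gamma5 lambda ++
  [ (fun x : R => Ccos (lambda * x)%C); (fun x : R => Csin (lambda * x)%C) ].

Definition triple_average (h : R) (q : R -> R) (x : R) : R :=
  / h ^ 3 *
  RInt (fun eta =>
    RInt (fun xi =>
      RInt q (xi - h / 2) (xi + h / 2))
      (eta - h / 2) (eta + h / 2))
    (x - h / 2) (x + h / 2).

(* c_0, ..., c_n are the flux coefficients on the stencil
   x + s h, x + (s+1) h, ..., x + (s+n) h for the space spanned by B.  Neither
   the base point x nor the data w enter c. *)
Definition flux_coefficients (B : list (R -> C)) (h : R) (s : Z) (n : nat)
    (c : nat -> R) : Prop :=
  forall (x : R) (w : nat -> R) (q : R -> R),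
    in_span B q ->
    (forall k : nat, (k <= n)%nat ->
       triple_average h q (x + IZR (s + Z.of_nat k) * h) = w k) ->
    q (x + 3 / 2 * h) - 2 * q (x + h / 2) + q (x - h / 2)
    = sum_f_R0 (fun k => c k * w k) n.

(* [c7 k] is C_k and [c5 m k] is C^m_k. *)
Definition ideal_weight (c7 : nat -> R) (c5 : nat -> nat -> R) (m : nat) : R :=
  let d0 := c7 0%nat / c5 0%nat 0%nat in
  let d1 := (c7 1%nat - d0 * c5 0%nat 1%nat) / c5 1%nat 0%nat in
  let d2 := (c7 2%nat - d0 * c5 0%nat 2%nat - d1 * c5 1%nat 1%nat)
            / c5 2%nat 0%nat in
  match m with 0%nat => d0 | 1%nat => d1 | _ => d2 end.

(* Here and below [V j] is the grid value v_{i+j}. *)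
Definition D3 (V : Z -> R) (m : nat) : R :=
  match m with
  | 0%nat | 1%nat =>
      - V (-1)%Z + 3 * V 0%Z - 3 * V 1%Z + V 2%Z
  | _ =>
      - 2 * V 0%Z + 7 * V 1%Z - 9 * V 2%Z + 5 * V 3%Z - V 4%Z
  end.

Definition D4 (V : Z -> R) (m : nat) : R :=
  let M := Z.of_nat m in
  V (-2 + M)%Z - 4 * V (-1 + M)%Z + 6 * V M - 4 * V (1 + M)%Z + V (2 + M)%Z.

Definition beta (V : Z -> R) (m : nat) : R := Rabs (D3 V m) + Rabs (D4 V m).

Definition zeta (V : Z -> R) : R := Rabs (beta V 0 - beta V 2).

Definition alpha (d : nat -> R) (V : Z -> R) (h : R) (m : nat) : R :=
  d m * (1 + zeta V / (beta V m + h ^ 2)).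

Definition omega (d : nat -> R) (V : Z -> R) (h : R) (m : nat) : R :=
  alpha d V h m / sum_f_R0 (alpha d V h) 2.

Definition grid_values (v : R -> R) (xi h : R) : Z -> R :=
  fun j => v (xi + IZR j * h).

Definition omega_plus (d : nat -> R) (v : R -> R) (xi h : R) (m : nat) : R :=
  omega d (grid_values v xi h) h m.

Definition omega_minus (d : nat -> R) (v : R -> R) (xi h : R) (m : nat) : R :=
  omega d (fun j => grid_values v xi h (j - 1)%Z) h m.

Definition smooth_on (a b : R) (f : R -> R) : Prop :=
  forall (n : nat) (x : R), a < x < b -> ex_derive_n f n x.

(* [Derive_n] is total, so the existence of the derivatives of order at most 3
   has to be required separately. *)
Definition smooth_third_derivative (v : R -> R) (a b : R) : Prop :=
  (forall (k : nat) (x : R), (k <= 3)%nat -> a < x < b -> ex_derive_n v k x) /\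
  smooth_on a b (Derive_n v 3).

Definition big_O (F : (R -> Prop) -> Prop) (f g : R -> R) : Prop :=
  exists K : R, F (fun h => Rabs (f h) <= K * Rabs (g h)).

(* Main.v *)
Require Import Defs.
From Stdlib Require Import Lra Lia.

(** The global indicator zeta is bounded by fifth differences of v, so zeta = O(h^5) and
    zeta / (beta_m + h^2) = O(h^3), whether or not derivatives of v vanish.  Since the ideal weights sum to 1,
    omega_m - d_m = d_m (z_m - T) / (1 + T) with z_m = zeta / (beta_m + h^2) and
    T = sum d_j z_j, so it suffices that the d_m stay bounded.

    Flux coefficients annihilate 1 and x, hence are second differences of numbers
    b_k with sum 1.  With t = lambda h / 2, testing on exponentials makes the b_k
    solve a small linear system in D = sinh^2 t and X = (t^3 / (sinh^3 t cosh t) - 1) / D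
    (for the trigonometric members, D = - sin^2 t and t^3 / (sin^3 t cos t)).
    The five-point coefficients are polynomials in D and X; the seven-point ones
    also involve the divided difference of X between its hyperbolic and
    trigonometric values, which is bounded because X + 1 = O(t^2). *)

(** * Hyperbolic and trigonometric functions in one notation *)

(** [true] selects cosh and sinh, [false] cos and sin. In both cases f'' = [eps e] f, so real and
    imaginary parameters share one set of identities. *)
Definition eps (e : bool) : R := if e then 1 else -1.
Definition gcos (e : bool) : R -> R := if e then cosh else cos.
Definition gsin (e : bool) : R -> R := if e then sinh else sin.

Lemma gsin_0 e : gsin e 0 = 0.
Proof. destruct e; simpl; [apply sinh_0 | apply sin_0]. Qed.

Lemma gcos_0 e : gcos e 0 = 1.
Proof. destruct e; simpl; [apply cosh_0 | apply cos_0]. Qed.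

Lemma gcos_plus e x y :
  gcos e (x + y) = gcos e x * gcos e y + eps e * gsin e x * gsin e y.
Proof.
  destruct e; simpl.
  - unfold cosh, sinh. rewrite Ropp_plus_distr, !exp_plus. field.
  - rewrite cos_plus. ring.
Qed.

Lemma gsin_plus e x y :
  gsin e (x + y) = gsin e x * gcos e y + gcos e x * gsin e y.
Proof.
  destruct e; simpl.
  - unfold cosh, sinh. rewrite Ropp_plus_distr, !exp_plus. field.
  - apply sin_plus.
Qed.

Lemma gcos_opp e x : gcos e (- x) = gcos e x.
Proof.
  destruct e; simpl; [unfold cosh; rewrite Ropp_involutive; field | apply cos_neg].
Qed.

Lemma gsin_opp e x : gsin e (- x) = - gsin e x.
Proof.
  destruct e; simpl; [unfold sinh; rewrite Ropp_involutive; field | apply sin_neg].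
Qed.

Lemma gcos_sqr e x : gcos e x ^ 2 = 1 + eps e * gsin e x ^ 2.
Proof.
  pose proof (gcos_plus e x (- x)) as H.
  rewrite Rplus_opp_r, gcos_0, gcos_opp, gsin_opp in H. lra.
Qed.

Lemma eps_sqr e : eps e * eps e = 1.
Proof. destruct e; simpl; ring. Qed.

Lemma is_derive_gcos e x : is_derive (gcos e) x (eps e * gsin e x).
Proof.
  destruct e; simpl; apply is_derive_Reals.
  - replace (1 * sinh x) with (sinh x) by ring. apply derivable_pt_lim_cosh.
  - replace (-1 * sin x) with (- sin x) by ring. apply derivable_pt_lim_cos.
Qed.

Lemma is_derive_gsin e x : is_derive (gsin e) x (gcos e x).
Proof.
  destruct e; simpl; apply is_derive_Reals;
    [apply derivable_pt_lim_sinh | apply derivable_pt_lim_sin].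
Qed.

Lemma Derive_gcos e y : Derive (fun x : R => gcos e x) y = eps e * gsin e y.
Proof. apply is_derive_unique, is_derive_gcos. Qed.

Lemma Derive_gsin e y : Derive (fun x : R => gsin e x) y = gcos e y.
Proof. apply is_derive_unique, is_derive_gsin. Qed.

Lemma gcos_bounded e x : Rabs x <= 1 -> Rabs (gcos e x) <= 3.
Proof.
  intros Hx. apply Rabs_le_between in Hx. destruct e; simpl.
  - unfold cosh. pose proof (exp_pos x). pose proof (exp_pos (- x)).
    assert (E : forall y, y <= 1 -> exp y <= 3).
    { intros y Hy. pose proof exp_le_3.
      destruct (Rle_lt_or_eq_dec _ _ Hy) as [L | ->]; [|lra].
      pose proof (exp_increasing _ _ L); lra. }
    pose proof (E x). pose proof (E (- x)). rewrite Rabs_pos_eq; lra.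
  - pose proof (COS_bound x). apply Rabs_le; lra.
Qed.

(** * Taylor bounds at 0 *)

(** Mean value theorem: f(x) = f'(c) x with |c| <= |x|. The factor 1/(n+1) of a true integration is
    given up. *)
Lemma power_bound_integrate (f df : R -> R) (K : R) (n : nat) :
  (forall x, is_derive f x (df x)) -> f 0 = 0 ->
  (forall x, Rabs x <= 1 -> Rabs (df x) <= K * Rabs x ^ n) ->
  forall x, Rabs x <= 1 -> Rabs (f x) <= K * Rabs x ^ S n.
Proof.
  intros Hd H0 Hb x Hx.
  destruct (MVT_gen f 0 x df) as [c [Hc E]].
  - intros; apply Hd.
  - intros y _. apply continuity_pt_filterlim.
    apply (ex_derive_continuous f y). now exists (df y).
  - assert (Hcx : Rabs c <= Rabs x).
    { revert Hc. unfold Rmin, Rmax, Rabs. destruct (Rle_dec 0 x);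
        repeat destruct Rcase_abs; lra. }
    replace (f x) with (df c * x) by (rewrite H0 in E; lra).
    rewrite Rabs_mult. simpl.
    assert (Hc1 := Hb c (Rle_trans _ _ _ Hcx Hx)).
    pose proof (Rabs_pos x). pose proof (Rabs_pos c).
    assert (HK : 0 <= K).
    { assert (Hb1 := Hb 1 ltac:(rewrite Rabs_R1; lra)).
      rewrite Rabs_R1, pow1 in Hb1. pose proof (Rabs_pos (df 1)). lra. }
    assert (Rabs c ^ n <= Rabs x ^ n) by (apply pow_incr; lra).
    replace (K * (Rabs x * Rabs x ^ n)) with ((K * Rabs x ^ n) * Rabs x) by ring.
    apply Rmult_le_compat_r; [lra|].
    apply Rle_trans with (1 := Hc1). now apply Rmult_le_compat_l.
Qed.

(** Repeated integration of |[gcos]| <= 3: each round raises the power by one and keeps the constant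
    3. *)
Lemma gcos_gsin_taylor e x : Rabs x <= 1 ->
  Rabs (gsin e x) <= 3 * Rabs x ^ 1 /\
  Rabs (gcos e x - 1 - eps e * x ^ 2 / 2) <= 3 * Rabs x ^ 4 /\
  Rabs (gsin e x - x - eps e * x ^ 3 / 6) <= 3 * Rabs x ^ 5.
Proof.
  assert (B1 : forall x, Rabs x <= 1 -> Rabs (gsin e x) <= 3 * Rabs x ^ 1).
  { apply (power_bound_integrate _ (gcos e)); [apply is_derive_gsin | apply gsin_0 |].
    intros y Hy. simpl. rewrite Rmult_1_r. now apply gcos_bounded. }
  assert (Ae : Rabs (eps e) = 1).
  { destruct e; simpl; unfold Rabs; destruct Rcase_abs; lra. }
  assert (B2 : forall x, Rabs x <= 1 -> Rabs (gcos e x - 1) <= 3 * Rabs x ^ 2).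
  { apply (power_bound_integrate _ (fun x => eps e * gsin e x)).
    - intros y. auto_derive; [exists (eps e * gsin e y); apply is_derive_gcos |].
      rewrite (Derive_gcos e y). ring.
    - rewrite gcos_0; ring.
    - intros y Hy. rewrite Rabs_mult, Ae, Rmult_1_l. auto. }
  assert (B3 : forall x, Rabs x <= 1 -> Rabs (gsin e x - x) <= 3 * Rabs x ^ 3).
  { apply (power_bound_integrate _ (fun x => gcos e x - 1)).
    - intros y. auto_derive; [exists (gcos e y); apply is_derive_gsin |].
      rewrite (Derive_gsin e y). ring.
    - rewrite gsin_0; ring.
    - exact B2. }
  assert (B4 : forall x, Rabs x <= 1 ->
    Rabs (gcos e x - 1 - eps e * x ^ 2 / 2) <= 3 * Rabs x ^ 4).
  { apply (power_bound_integrate _ (fun x => eps e * (gsin e x - x))).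
    - intros y. auto_derive; [exists (eps e * gsin e y); apply is_derive_gcos |].
      rewrite (Derive_gcos e y). field.
    - rewrite gcos_0; field.
    - intros y Hy. rewrite Rabs_mult, Ae, Rmult_1_l. auto. }
  assert (B5 : forall x, Rabs x <= 1 ->
    Rabs (gsin e x - x - eps e * x ^ 3 / 6) <= 3 * Rabs x ^ 5).
  { apply (power_bound_integrate _ (fun x => gcos e x - 1 - eps e * x ^ 2 / 2)).
    - intros y. auto_derive; [exists (gcos e y); apply is_derive_gsin |].
      rewrite (Derive_gsin e y). field.
    - rewrite gsin_0; field.
    - exact B4. }
  auto.
Qed.

(** * Triple averages of the basis functions *)

(** An eigenfunction of the integral over a window of width h stays one under each of the three
    nested integrals. This covers every basis function except x^2. *)
Lemma triple_average_eigen (h m : R) (q : R -> R) :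
  (forall x, ex_RInt q (x - h / 2) (x + h / 2)) ->
  (forall x, RInt q (x - h / 2) (x + h / 2) = m * q x) ->
  forall x, triple_average h q x = / h ^ 3 * (m ^ 3 * q x).
Proof.
  intros Hex Hm x. unfold triple_average. f_equal.
  assert (Hs : forall a z, RInt (fun y => a * q y) (z - h / 2) (z + h / 2)
                           = a * (m * q z)).
  { intros a z. rewrite <- Hm. apply is_RInt_unique.
    exact (is_RInt_scal q _ _ a _ (RInt_correct _ _ _ (Hex z))). }
  assert (H2 : forall z, RInt (fun xi => RInt q (xi - h / 2) (xi + h / 2))
                           (z - h / 2) (z + h / 2) = m * m * q z).
  { intros z. rewrite (RInt_ext _ _ _ _ (fun y _ => Hm y)), Hs.
    change (m * (m * q z) = m * m * q z). ring. }
  rewrite (RInt_ext _ _ _ _ (fun y _ => H2 y)), Hs.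
  change (m * m * (m * q x) = m ^ 3 * q x). ring.
Qed.

Lemma RInt_antiderivative (Q q : R -> R) (x y : R) :
  (forall z, is_derive Q z (q z)) -> (forall z, ex_derive q z) ->
  is_RInt q x y (Q y - Q x).
Proof.
  intros HQ Hq. apply (is_RInt_derive Q q); intros z _;
    [apply HQ | apply (ex_derive_continuous q z), Hq].
Qed.

Lemma triple_average_const (h k x : R) : h <> 0 ->
  triple_average h (fun _ => k) x = k.
Proof.
  intros Hh. rewrite (triple_average_eigen h h).
  - field; auto.
  - intros; apply ex_RInt_const.
  - intros. rewrite RInt_const. unfold scal; simpl; unfold mult; simpl. field.
Qed.

Lemma triple_average_id (h x : R) : h <> 0 ->
  triple_average h (fun x => x) x = x.
Proof.
  intros Hh.
  assert (H : forall z, is_RInt (fun x => x) (z - h / 2) (z + h / 2) (h * z)).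
  { intros z. replace (h * z) with ((z + h / 2) ^ 2 / 2 - (z - h / 2) ^ 2 / 2) by field.
    apply (RInt_antiderivative (fun x => x ^ 2 / 2)); intros; auto_derive; auto; field. }
  rewrite (triple_average_eigen h h).
  - field; auto.
  - intros z; eexists; apply H.
  - intros z; apply is_RInt_unique, H.
Qed.

(** x^2 is not an eigenfunction: each average adds h^2/12, and three add h^2/4. The auxiliary
    formula carries a factor j and a shift k so that it applies to its own output. *)
Lemma triple_average_sqr (h x : R) : h <> 0 ->
  triple_average h (fun x => x ^ 2) x = x ^ 2 + h ^ 2 / 4.
Proof.
  intros Hh.
  assert (H : forall j k z, RInt (fun x => j * (x ^ 2 + k)) (z - h / 2) (z + h / 2)
                          = h * j * (z ^ 2 + (k + h ^ 2 / 12))).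
  { intros j k z. apply is_RInt_unique.
    replace (h * j * (z ^ 2 + (k + h ^ 2 / 12))) with
      (j * ((z + h / 2) ^ 3 / 3 + k * (z + h / 2))
       - j * ((z - h / 2) ^ 3 / 3 + k * (z - h / 2))) by field.
    apply (RInt_antiderivative (fun x => j * (x ^ 3 / 3 + k * x)));
      intros; auto_derive; auto; field. }
  unfold triple_average.
  assert (H1 : forall z, RInt (fun x => x ^ 2) (z - h / 2) (z + h / 2)
                          = h * (z ^ 2 + h ^ 2 / 12)).
  { intros z. rewrite (RInt_ext _ (fun x => 1 * (x ^ 2 + 0)))
      by (intros y _; change (y ^ 2 = 1 * (y ^ 2 + 0)); ring).
    rewrite H. change (h * 1 * (z ^ 2 + (0 + h ^ 2 / 12)) = h * (z ^ 2 + h ^ 2 / 12)).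
    ring. }
  assert (H2 : forall z, RInt (fun y => RInt (fun x => x ^ 2) (y - h / 2) (y + h / 2))
     (z - h / 2) (z + h / 2) = h * h * (z ^ 2 + (h ^ 2 / 12 + h ^ 2 / 12))).
  { intros z. rewrite (RInt_ext _ _ _ _ (fun y _ => H1 y)). now rewrite H. }
  rewrite (RInt_ext _ _ _ _ (fun y _ => H2 y)), H. field; auto.
Qed.

Lemma is_derive_gcos_scal e k x :
  is_derive (fun x => gcos e (k * x)) x (eps e * k * gsin e (k * x)).
Proof.
  auto_derive; [eexists; apply is_derive_gcos |].
  rewrite (Derive_gcos e (k * x)). ring.
Qed.

Lemma is_derive_gsin_scal e k x :
  is_derive (fun x => gsin e (k * x)) x (k * gcos e (k * x)).
Proof.
  auto_derive; [eexists; apply is_derive_gsin |].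
  rewrite (Derive_gsin e (k * x)). ring.
Qed.

(** The addition formulas at k z plus and minus k h/2 make [gcos] an eigenfunction of the window
    integral, with eigenvalue h gsin(t)/t for t = k h/2. *)
Lemma triple_average_gcos e (h k x : R) : h <> 0 -> k <> 0 ->
  triple_average h (fun x => gcos e (k * x)) x
  = (gsin e (k * h / 2) / (k * h / 2)) ^ 3 * gcos e (k * x).
Proof.
  intros Hh Hk.
  assert (H : forall z, is_RInt (fun x => gcos e (k * x)) (z - h / 2) (z + h / 2)
     (2 * gsin e (k * h / 2) / k * gcos e (k * z))).
  { intros z. replace (_ / k * _) with
      (/ k * gsin e (k * (z + h / 2)) - / k * gsin e (k * (z - h / 2))).
    - apply (RInt_antiderivative (fun x => / k * gsin e (k * x))); intros y.
      + replace (gcos e (k * y)) with (/ k * (k * gcos e (k * y))) by (field; auto).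
        apply (is_derive_scal (fun x => gsin e (k * x))), is_derive_gsin_scal.
      + eexists; apply is_derive_gcos_scal.
    - replace (k * (z + h / 2)) with (k * z + k * h / 2) by field.
      replace (k * (z - h / 2)) with (k * z + - (k * h / 2)) by field.
      rewrite !gsin_plus, gsin_opp, gcos_opp. field; auto. }
  rewrite (triple_average_eigen h (2 * gsin e (k * h / 2) / k)).
  - field; auto.
  - intros z; eexists; apply H.
  - intros z; apply is_RInt_unique, H.
Qed.

Lemma triple_average_gsin e (h k x : R) : h <> 0 -> k <> 0 ->
  triple_average h (fun x => gsin e (k * x)) x
  = (gsin e (k * h / 2) / (k * h / 2)) ^ 3 * gsin e (k * x).
Proof.
  intros Hh Hk.
  assert (H : forall z, is_RInt (fun x => gsin e (k * x)) (z - h / 2) (z + h / 2)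
     (2 * gsin e (k * h / 2) / k * gsin e (k * z))).
  { intros z. replace (_ / k * _) with
      (eps e / k * gcos e (k * (z + h / 2)) - eps e / k * gcos e (k * (z - h / 2))).
    - apply (RInt_antiderivative (fun x => eps e / k * gcos e (k * x))); intros y.
      + replace (gsin e (k * y)) with (eps e / k * (eps e * k * gsin e (k * y))).
        2: { transitivity (eps e * eps e * gsin e (k * y)); [field; auto|].
             rewrite eps_sqr; ring. }
        apply (is_derive_scal (fun x => gcos e (k * x))), is_derive_gcos_scal.
      + eexists; apply is_derive_gsin_scal.
    - replace (k * (z + h / 2)) with (k * z + k * h / 2) by field.
      replace (k * (z - h / 2)) with (k * z + - (k * h / 2)) by field.
      rewrite !gcos_plus, gsin_opp, gcos_opp.
      transitivity (eps e * eps e * (2 * gsin e (k * h / 2) / k * gsin e (k * z)));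
        [field; auto | rewrite eps_sqr; ring]. }
  rewrite (triple_average_eigen h (2 * gsin e (k * h / 2) / k)).
  - field; auto.
  - intros z; eexists; apply H.
  - intros z; apply is_RInt_unique, H.
Qed.

(** * Real-valued members of the complex spans *)

(** The two admissible kinds of [lambda]: the real number k, or i k. *)
Definition parameter (e : bool) (k : R) : C := if e then (k, 0) else (0, k).

Lemma Cexp_real r : Cexp (r, 0) = RtoC (exp r).
Proof.
  unfold Cexp; simpl. rewrite cos_0, sin_0. apply injective_projections; simpl; ring.
Qed.

Lemma Cexp_imag r : Cexp (0, r) = (cos r, sin r).
Proof.
  unfold Cexp; simpl. rewrite exp_0. apply injective_projections; simpl; ring.
Qed.

Lemma Cexp_real_mult k x : Cexp (RtoC k * RtoC x) = RtoC (exp (k * x)).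
Proof. rewrite <- RtoC_mult. apply Cexp_real. Qed.

Lemma Cexp_imag_mult k x : Cexp ((0, k) * RtoC x) = (cos (k * x), sin (k * x)).
Proof.
  rewrite <- Cexp_imag. f_equal. apply injective_projections; simpl; ring.
Qed.

Lemma Gamma5_span (e : bool) (k : R) (q : R -> R) :
  In q [ (fun _ => 1); (fun x => x); (fun x => x ^ 2);
         (fun x => gcos e (k * x)); (fun x => gsin e (k * x)) ] ->
  in_span (Gamma5 (parameter e k)) q.
Proof.
  assert (Hp : forall x, Cexp (parameter e k * RtoC x)
      = (if e then exp (k * x) else cos (k * x), if e then 0 else sin (k * x))).
  { intros x. destruct e; [apply (Cexp_real_mult k) | apply (Cexp_imag_mult k)]. }
  assert (Hm : forall x, Cexp (- parameter e k * RtoC x)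
      = (if e then exp (- (k * x)) else cos (k * x), if e then 0 else - sin (k * x))).
  { intros x. destruct e; simpl parameter.
    - replace (- (k, 0) * RtoC x)%C with (- (k * x), 0) by
        (apply injective_projections; simpl; ring).
      apply (Cexp_real (- (k * x))).
    - replace (- (0, k) * RtoC x)%C with (0, - (k * x)) by
        (apply injective_projections; simpl; ring).
      rewrite Cexp_imag, cos_neg, sin_neg. reflexivity. }
  set (half := RtoC (/ 2)).
  (* For the sine, 1/(2i) = -i/2 replaces the factor 1/2 of sinh. *)
  set (halfs := if e then RtoC (/ 2) else (0, - / 2)).
  intros Hq.
  (* The lists below may have fewer than five entries, since [nth] supplies the default 0. *)
  assert (Hcoef : exists l : list C, forall x, RtoC (q x) =
     (nth 0 l 0 * 1 + nth 1 l 0 * RtoC x + nth 2 l 0 * RtoC (x ^ 2)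
      + nth 3 l 0 * Cexp (parameter e k * RtoC x)
      + nth 4 l 0 * Cexp (- parameter e k * RtoC x))%C).
  { simpl in Hq. destruct Hq as [<-|[<-|[<-|[<-|[<-|[]]]]]].
    - exists [RtoC 1]; intros x; simpl. ring.
    - exists [RtoC 0; RtoC 1]; intros x; simpl. ring.
    - exists [RtoC 0; RtoC 0; RtoC 1]; intros x; simpl. ring.
    - exists [RtoC 0; RtoC 0; RtoC 0; half; half]; intros x; simpl nth.
      rewrite Hp, Hm. unfold half. destruct e; simpl gcos; unfold cosh;
        apply injective_projections; simpl; field.
    - exists [RtoC 0; RtoC 0; RtoC 0; halfs; (- halfs)%C]; intros x; simpl nth.
      rewrite Hp, Hm. unfold halfs. destruct e; simpl gsin; unfold sinh;
        apply injective_projections; simpl; field. }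
  destruct Hcoef as [l Hl]. exists (fun j => nth j l (RtoC 0)). intros x.
  replace (length (Gamma5 (parameter e k)) - 1)%nat with 4%nat by reflexivity.
  rewrite !sum_Sn, sum_O. exact (Hl x).
Qed.

(** The coefficients are padded with zeros. As [B] is nonempty, truncated subtraction in
    [length B - 1] is exact. *)
Lemma in_span_app (B B' : list (R -> C)) (q : R -> R) :
  (0 < length B)%nat -> in_span B q -> in_span (B ++ B') q.
Proof.
  intros HB [a Ha].
  exists (fun j => if Nat.ltb j (length B) then a j else RtoC 0). intros x.
  rewrite Ha, length_app.
  set (f := fun j => ((if Nat.ltb j (length B) then a j else RtoC 0)
     * nth j (B ++ B') (fun _ => RtoC 0) x)%C).
  assert (Hd : forall d, sum_n f (length B - 1 + d) = sum_n f (length B - 1)).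
  { induction d as [|d IH]; [now rewrite Nat.add_0_r|].
    rewrite Nat.add_succ_r, sum_Sn, IH. unfold f at 2.
    destruct (Nat.ltb_spec (S (length B - 1 + d)) (length B)); [lia|].
    rewrite Cmult_0_l. apply Cplus_0_r. }
  replace (length B + length B' - 1)%nat with (length B - 1 + length B')%nat by lia.
  rewrite Hd. apply sum_n_ext_loc. intros j Hj. unfold f.
  destruct (Nat.ltb_spec j (length B)); [|lia]. now rewrite app_nth1.
Qed.

(* cos (i y) = cosh y and sin (i y) = i sinh y, so the last two members of
   [Gamma7] are the pair of the opposite kind to that of [Gamma5]. *)
Lemma Gamma7_span (e e' : bool) (k : R) (q : R -> R) :
  In q [ (fun _ => 1); (fun x => x); (fun x => x ^ 2);
         (fun x => gcos e' (k * x)); (fun x => gsin e' (k * x)) ] ->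
  in_span (Gamma7 (parameter e k)) q.
Proof.
  intros Hq.
  assert (Hsame : e = e' -> in_span (Gamma7 (parameter e k)) q).
  { intros ->. apply in_span_app; [simpl; lia|]. now apply (Gamma5_span e'). }
  assert (Hpol : In q [ (fun _ => 1); (fun x => x); (fun x => x ^ 2) ] ->
     in_span (Gamma7 (parameter e k)) q).
  { intros Hq'. apply in_span_app; [simpl; lia|]. apply Gamma5_span.
    simpl in *. tauto. }
  destruct (Bool.bool_dec e e') as [|Hne]; [auto|].
  simpl in Hq. destruct Hq as [Hq|[Hq|[Hq|Hq]]];
    try (apply Hpol; simpl; tauto).
  assert (Hp : forall x, Cexp (Ci * (parameter e k * RtoC x))
      = (if e then cos (k * x) else exp (- (k * x)), if e then sin (k * x) else 0)).
  { intros x. unfold Ci. destruct e; simpl parameter.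
    - replace ((0, 1) * ((k, 0) * RtoC x))%C with (0, k * x) by
        (apply injective_projections; simpl; ring). apply Cexp_imag.
    - replace ((0, 1) * ((0, k) * RtoC x))%C with (- (k * x), 0) by
        (apply injective_projections; simpl; ring). apply Cexp_real. }
  assert (Hm : forall x, Cexp (- (Ci * (parameter e k * RtoC x)))
      = (if e then cos (k * x) else exp (k * x), if e then - sin (k * x) else 0)).
  { intros x. unfold Ci. destruct e; simpl parameter.
    - replace (- ((0, 1) * ((k, 0) * RtoC x)))%C with (0, - (k * x)) by
        (apply injective_projections; simpl; ring).
      now rewrite Cexp_imag, cos_neg, sin_neg.
    - replace (- ((0, 1) * ((0, k) * RtoC x)))%C with (k * x, 0) by
        (apply injective_projections; simpl; ring). apply Cexp_real. }
  assert (Hc : forall x, Ccos (parameter e k * RtoC x) = RtoC (gcos e' (k * x))).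
  { intros x. unfold Ccos. rewrite Hp, Hm.
    destruct e, e'; try congruence; simpl gcos; unfold cosh;
      apply injective_projections; simpl; field. }
  assert (Hs : forall x, ((if e then RtoC 1 else - Ci) * Csin (parameter e k * RtoC x))%C
                = RtoC (gsin e' (k * x))).
  { intros x. unfold Csin. rewrite Hp, Hm. unfold Ci.
    destruct e, e'; try congruence; simpl gsin; unfold sinh;
      apply injective_projections; simpl; field. }
  assert (Hcoef : exists a5 a6 : C, forall x, RtoC (q x) =
     (a5 * Ccos (parameter e k * RtoC x) + a6 * Csin (parameter e k * RtoC x))%C).
  { destruct Hq as [<-|[<-|[]]].
    - exists (RtoC 1), (RtoC 0). intros x. rewrite Hc. ring.
    - exists (RtoC 0), (if e then RtoC 1 else - Ci)%C. intros x. rewrite <- Hs. ring. }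
  destruct Hcoef as [a5 [a6 Ha]].
  exists (fun j => nth j [RtoC 0; RtoC 0; RtoC 0; RtoC 0; RtoC 0; a5; a6] (RtoC 0)).
  intros x. rewrite Ha.
  replace (length (Gamma7 (parameter e k)) - 1)%nat with 6%nat by reflexivity.
  rewrite !sum_Sn, sum_O. simpl nth.
  unfold plus; simpl. ring.
Qed.

(** * Moment conditions on the flux coefficients *)

(* Signed offset of a grid point from the interface, in units of h / 2. *)
Definition node (s : Z) (k : nat) : R := IZR (2 * (s + Z.of_nat k) - 1).

(* The conditions obtained by testing flux coefficients on a basis, at t = lambda h / 2. *)
Record moments (e : bool) (t : R) (s : Z) (n : nat) (c : nat -> R) : Prop := {
  moment_0 : sum_f_R0 c n = 0;
  moment_1 : sum_f_R0 (fun k => c k * node s k) n = 0;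
  moment_2 : sum_f_R0 (fun k => c k * node s k ^ 2) n = 8;
  moment_cos :
    (gsin e t / t) ^ 3
      * sum_f_R0 (fun k => c k * gcos e (t * node s k)) n
    = 4 * eps e * gsin e t ^ 2;
  moment_sin :
    (gsin e t / t) ^ 3
      * sum_f_R0 (fun k => c k * gsin e (t * node s k)) n
    = 0 }.

(** The defining identity of the coefficients holds for every base point and all data, so it can be
    tested on each real basis function with that function's own averages as data. *)
Lemma flux_coefficients_moments (B : list (R -> C)) (e : bool) (k h : R) (s : Z)
    (n : nat) (c : nat -> R) :
  h <> 0 -> k <> 0 ->
  (forall q, In q [ (fun _ => 1); (fun x => x); (fun x => x ^ 2);
         (fun x => gcos e (k * x)); (fun x => gsin e (k * x)) ] -> in_span B q) ->
  flux_coefficients B h s n c -> moments e (k * h / 2) s n c.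
Proof.
  intros Hh Hk HB Hc.
  assert (Hn : forall j, node s j = 2 * IZR (s + Z.of_nat j) - 1).
  { intros j. unfold node. now rewrite minus_IZR, mult_IZR. }
  assert (Hq : forall q, In q [ (fun _ => 1); (fun x => x); (fun x => x ^ 2);
         (fun x => gcos e (k * x)); (fun x => gsin e (k * x)) ] ->
     q h - 2 * q 0 + q (- h) = sum_f_R0 (fun j => c j *
        triple_average h q (h / 2 * node s j)) n).
  { intros q Hq.
    (* The base point -h/2 puts the interface at 0, and the grid points at h/2 times [node]. *)
    rewrite <- (Hc (- h / 2) (fun j =>
       triple_average h q (h / 2 * node s j)) q (HB q Hq)).
    - f_equal; [f_equal; [f_equal | do 2 f_equal] | f_equal]; field.
    - intros j _. f_equal. rewrite Hn. field. }
  assert (H0 : sum_f_R0 c n = 0).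
  { rewrite (sum_eq _ (fun j => c j * triple_average h (fun _ => 1)
       (h / 2 * node s j))).
    - rewrite <- Hq by (simpl; tauto). ring.
    - intros j _. rewrite triple_average_const by auto. ring. }
  assert (H1 : sum_f_R0 (fun k => c k * node s k) n = 0).
  { apply (Rmult_eq_reg_l (h / 2)); [|lra]. rewrite scal_sum.
    rewrite (sum_eq _ (fun j => c j * triple_average h (fun x => x)
       (h / 2 * node s j))).
    - rewrite <- (Hq (fun x => x)) by (simpl; tauto). ring.
    - intros j _. rewrite triple_average_id by auto. ring. }
  split; auto.
  - apply (Rmult_eq_reg_l (h ^ 2 / 4)).
    2: { apply Rgt_not_eq. pose proof (pow2_gt_0 h Hh). lra. }
    (* The constant h^2/4 in the average of x^2 contributes a multiple of the sum of the c_k, which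
       vanishes. *)
    replace (h ^ 2 / 4 * 8) with (2 * h ^ 2 - h ^ 2 / 4 * sum_f_R0 c n)
      by (rewrite H0; field).
    replace (2 * h ^ 2) with (h ^ 2 - 2 * 0 ^ 2 + (- h) ^ 2) by ring.
    rewrite (Hq (fun x => x ^ 2)) by (simpl; tauto).
    rewrite !scal_sum, <- minus_sum. apply sum_eq. intros j _.
    rewrite triple_average_sqr by auto. field.
  (* With t = k h/2, the second difference is 2 (gcos(2t) - 1) = 4 eps gsin(t)^2. *)
  - replace (4 * eps e * gsin e (k * h / 2) ^ 2)
      with (gcos e (k * h) - 2 * gcos e (k * 0) + gcos e (k * - h)).
    + rewrite (Hq (fun x => gcos e (k * x))) by (simpl; tauto).
      rewrite scal_sum. apply sum_eq. intros j _.
      rewrite triple_average_gcos by auto.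
      replace (k * (h / 2 * node s j))
        with (k * h / 2 * node s j) by field. ring.
    + rewrite Rmult_0_r, gcos_0.
      replace (k * - h) with (- (k * h)) by ring. rewrite gcos_opp.
      replace (k * h) with (k * h / 2 + k * h / 2) at 1 2 by field.
      rewrite gcos_plus. pose proof (gcos_sqr e (k * h / 2)). lra.
  - transitivity (gsin e (k * h) - 2 * gsin e (k * 0) + gsin e (k * - h)).
    + rewrite (Hq (fun x => gsin e (k * x))) by (simpl; tauto).
      rewrite scal_sum. apply sum_eq. intros j _.
      rewrite triple_average_gsin by auto.
      replace (k * (h / 2 * node s j))
        with (k * h / 2 * node s j) by field. ring.
    + rewrite Rmult_0_r, gsin_0.
      replace (k * - h) with (- (k * h)) by ring. rewrite gsin_opp. ring.
Qed.

(** * Boundedness along a filter *)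

Definition bounded (F : (R -> Prop) -> Prop) (f : R -> R) : Prop :=
  exists K, F (fun h => Rabs (f h) <= K).

Section Bounded.
Context (F : (R -> Prop) -> Prop) {FF : Filter F}.

Lemma bounded_ext f g : F (fun h => f h = g h) -> bounded F f -> bounded F g.
Proof.
  intros H [K HK]. exists K. generalize (filter_and _ _ H HK).
  apply filter_imp. now intros h [<- Hh].
Qed.

Lemma bounded_const k : bounded F (fun _ => k).
Proof. exists (Rabs k). apply filter_forall. intros; apply Rle_refl. Qed.

Lemma bounded_plus f g :
  bounded F f -> bounded F g -> bounded F (fun h => f h + g h).
Proof.
  intros [K HK] [L HL]. exists (K + L). generalize (filter_and _ _ HK HL).
  apply filter_imp. intros h [H1 H2].
  apply Rle_trans with (1 := Rabs_triang _ _). lra.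
Qed.

Lemma bounded_mult f g :
  bounded F f -> bounded F g -> bounded F (fun h => f h * g h).
Proof.
  intros [K HK] [L HL]. exists (K * L). generalize (filter_and _ _ HK HL).
  apply filter_imp. intros h [H1 H2]. rewrite Rabs_mult.
  apply Rmult_le_compat; auto; apply Rabs_pos.
Qed.

Lemma bounded_opp f : bounded F f -> bounded F (fun h => - f h).
Proof.
  intros [K HK]. exists K. revert HK. apply filter_imp. intros h.
  now rewrite Rabs_Ropp.
Qed.

Lemma bounded_minus f g :
  bounded F f -> bounded F g -> bounded F (fun h => f h - g h).
Proof. intros Hf Hg. apply bounded_plus; auto. now apply bounded_opp. Qed.

Lemma bounded_pow f n : bounded F f -> bounded F (fun h => f h ^ n).
Proof.
  intros Hf. induction n; simpl; [apply bounded_const | now apply bounded_mult].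
Qed.

Lemma bounded_div f g (delta : R) : 0 < delta -> F (fun h => delta <= Rabs (g h)) ->
  bounded F f -> bounded F (fun h => f h / g h).
Proof.
  intros Hd Hg Hf. apply bounded_mult; auto. exists (/ delta).
  revert Hg. apply filter_imp. intros h Hh.
  rewrite Rabs_inv. now apply Rinv_le_contravar.
Qed.

End Bounded.

Ltac bounded := repeat first
  [ assumption | match goal with |- Filter _ => exact _ end | apply bounded_const | apply bounded_plus | apply bounded_minus
  | apply bounded_mult | apply bounded_opp | apply bounded_pow ].

Lemma bounded_comp F G {FF : Filter F} {FG : Filter G} (phi f : R -> R) :
  filterlim phi F G -> bounded G f -> bounded F (fun h => f (phi h)).
Proof. intros Hphi [K HK]. exists K. exact (Hphi _ HK). Qed.

Lemma punctured_small delta : 0 < delta -> locally' 0 (fun t => 0 < Rabs t < delta).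
Proof.
  intros Hd. exists (mkposreal _ Hd). intros t Ht Hne.
  split; [now apply Rabs_pos_lt|].
  change (Rabs (t + - 0) < delta) in Ht.
  now rewrite Ropp_0, Rplus_0_r in Ht.
Qed.

(** * The symbols D and X near 0 *)

(** Equals sinh^2 t or -sin^2 t, so that gcos^2 = 1 + D in both cases. *)
Definition dsym (e : bool) (t : R) : R := eps e * gsin e t ^ 2.

(* (t / gsin t)^3 / gcos t = 1 + D X, where D is [dsym] and X is [xsym]. *)
Definition xsym (e : bool) (t : R) : R :=
  ((t / gsin e t) ^ 3 / gcos e t - 1) / dsym e t.

(** With gsin t = t (1 + t^2 w) and gcos t = 1 + t^2 z, the Taylor bounds give w = eps/6 + O(t^2)
    and z = eps/2 + O(t^2). The leading term of X is then -(3w + z)/eps, which tends to -1. *)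
Lemma symbols_near_0 (e : bool) :
  bounded (locally' 0) (fun t => (xsym e t + 1) / t ^ 2) /\
  locally' 0 (fun t => gcos e t <> 0 /\ t / 2 * (t / 2) <= gsin e t ^ 2 <= / 100).
Proof.
  set (e1 := fun t => (gsin e t - t - eps e * t ^ 3 / 6) / t ^ 5).
  set (e2 := fun t => (gcos e t - 1 - eps e * t ^ 2 / 2) / t ^ 4).
  (* For |t| < 1/20 the factors 1 + t^2 w and 1 + t^2 z lie between 1/2 and 2, and gsin^2 <= 4 t^2
     <= 1/100. *)
  assert (Hsmall := punctured_small (/ 20) ltac:(lra)).
  assert (Hdiv : forall x y n, y <> 0 -> Rabs x <= 3 * Rabs y ^ n -> Rabs (x / y ^ n) <= 3).
  { intros x y n Hy Hx. unfold Rdiv. rewrite Rabs_mult, Rabs_inv, <- RPow_abs.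
    apply Rle_div_l; [apply pow_lt, Rabs_pos_lt, Hy | exact Hx]. }
  assert (Hall : locally' 0 (fun t => 0 < Rabs t < / 20 /\ t <> 0 /\
      Rabs (e1 t) <= 3 /\ Rabs (e2 t) <= 3)).
  { revert Hsmall. apply filter_imp. intros t Ht.
    assert (t <> 0) by (intros ->; rewrite Rabs_R0 in Ht; lra).
    destruct (gcos_gsin_taylor e t) as [_ [H2 H1]]; [lra|].
    unfold e1, e2. auto. }
  set (w := fun t => eps e / 6 + t ^ 2 * e1 t).
  set (z := fun t => eps e / 2 + t ^ 2 * e2 t).
  assert (Hw : forall t, t <> 0 -> gsin e t = t * (1 + t ^ 2 * w t)).
  { intros t Ht. unfold w, e1. field; auto. }
  assert (Hz : forall t, t <> 0 -> gcos e t = 1 + t ^ 2 * z t).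
  { intros t Ht. unfold z, e2. field; auto. }
  assert (Hest : locally' 0 (fun t => 0 < Rabs t < / 20 /\ t <> 0 /\
      / 2 <= 1 + t ^ 2 * w t <= 2 /\ / 2 <= 1 + t ^ 2 * z t <= 2)).
  { revert Hall. apply filter_imp. intros t [Ht [Hne [H1 H2]]]. split; [auto|]. split; [auto|].
    apply Rabs_le_between in H1. apply Rabs_le_between in H2.
    assert (HT : 0 <= t ^ 2 <= / 400).
    { rewrite <- pow2_abs. split; [apply pow2_ge_0|].
      replace (/ 400) with ((/ 20) ^ 2) by field. apply pow_incr; lra. }
    assert (H1' : -1 <= w t <= 1) by (unfold w; destruct e; simpl eps; nra).
    assert (H2' : -1 <= z t <= 1) by (unfold z; destruct e; simpl eps; nra).
    nra. }
  split.
  - assert (B1 : bounded (locally' 0) e1).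
    { exists 3. revert Hall. apply filter_imp. tauto. }
    assert (B2 : bounded (locally' 0) e2).
    { exists 3. revert Hall. apply filter_imp. tauto. }
    assert (BT : bounded (locally' 0) (fun t => t)).
    { exists (/ 20). revert Hsmall. apply filter_imp. intros; lra. }
    assert (BW : bounded (locally' 0) w) by (unfold w; bounded).
    assert (BZ : bounded (locally' 0) z) by (unfold z; bounded).
    set (S := fun t => 1 + t ^ 2 * w t). set (c := fun t => 1 + t ^ 2 * z t).
    assert (BS : bounded (locally' 0) S) by (unfold S; bounded).
    assert (Bc : bounded (locally' 0) c) by (unfold c; bounded).
    (* Here X + 1 = (1 - S^3 c + D S^3 c) / (D S^3 c) with D = eps t^2 S^2. The terms of order t^2
       in the numerator cancel because 3w + z = eps + t^2 (3 e1 + e2); the remainder is divisible by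
       t^4, which leaves the denominator S^5 c. *)
    apply bounded_ext with (fun t =>
      eps e * (eps e * (w t * (1 + S t + S t ^ 2 + S t ^ 3 + S t ^ 4) * c t + z t)
       - (3 * e1 t + e2 t)
       - (3 * w t ^ 2 + 3 * w t * z t + (w t ^ 3 + 3 * w t ^ 2 * z t) * t ^ 2
          + w t ^ 3 * z t * (t ^ 2) ^ 2)) / (S t ^ 5 * c t)).
    + exact _.
    + revert Hest. apply filter_imp. intros t [_ [Hne [HS Hc]]].
      unfold xsym, dsym. rewrite Hw, Hz by auto. unfold S, c.
      assert (E1 : e1 t = (w t - eps e / 6) / t ^ 2) by (unfold w; field; auto).
      assert (E2 : e2 t = (z t - eps e / 2) / t ^ 2) by (unfold z; field; auto).
      rewrite E1, E2.
      destruct e; simpl eps; field; repeat split; auto; lra.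
    + apply bounded_div with (/ 64); [exact _ | lra | | bounded].
      revert Hest. apply filter_imp. intros t [_ [Hne [HS Hc]]]. fold (S t) in HS. fold (c t) in Hc.
      assert (/ 32 <= S t ^ 5).
      { replace (/ 32) with ((/ 2) ^ 5) by field. apply pow_incr; lra. }
      rewrite Rabs_pos_eq; nra.
  - revert Hest. apply filter_imp. intros t [Ht [Hne [HS Hc]]].
    rewrite Hw, Hz by auto. split; [lra|].
    rewrite Rpow_mult_distr.
    assert (HT : 0 <= t ^ 2 <= / 400).
    { rewrite <- pow2_abs. split; [apply pow2_ge_0|].
      replace (/ 400) with ((/ 20) ^ 2) by field. apply pow_incr; lra. }
    assert (/ 4 <= (1 + t ^ 2 * w t) ^ 2 <= 4) by nra. nra.
Qed.

(** * Reduction to equations polynomial in D *)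

(* For odd y, cos (y t) = cos t * (polynomial in D) and
   sin (y t) = sin t * (polynomial in D), where D is [dsym]. *)
Definition rcos (D : R) (y : Z) : R :=
  match Z.abs y with
  | 1%Z => 1
  | 3%Z => 1 + 4 * D
  | 5%Z => 1 + 12 * D + 16 * D ^ 2
  | _ => 1 + 24 * D + 80 * D ^ 2 + 64 * D ^ 3
  end.

Definition rsin (D : R) (y : Z) : R :=
  IZR (Z.sgn y) *
  match Z.abs y with
  | 1%Z => 1
  | 3%Z => 3 + 4 * D
  | 5%Z => 5 + 20 * D + 16 * D ^ 2
  | _ => 7 + 56 * D + 112 * D ^ 2 + 64 * D ^ 3
  end.

(** Start at t and add 2t repeatedly, with gcos(2t) = 1 + 2D; parity gives the negative multiples.
    On the list of offsets the default branch of [rcos] and [rsin] means y = 7. *)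
Lemma odd_multiples e t y : In y [-5; -3; -1; 1; 3; 5; 7]%Z ->
  gcos e (t * IZR y) = gcos e t * rcos (dsym e t) y /\
  gsin e (t * IZR y) = gsin e t * rsin (dsym e t) y.
Proof.
  set (D := dsym e t).
  assert (Hc : gcos e t * gcos e t = 1 + D).
  { pose proof (gcos_sqr e t). unfold D, dsym. lra. }
  assert (H2c : gcos e (2 * t) = 1 + 2 * D).
  { replace (2 * t) with (t + t) by ring. rewrite gcos_plus, Hc. unfold D, dsym. ring. }
  assert (H2s : gsin e (2 * t) = 2 * gsin e t * gcos e t).
  { replace (2 * t) with (t + t) by ring. rewrite gsin_plus. ring. }
  assert (step : forall x p q, gcos e x = gcos e t * p -> gsin e x = gsin e t * q ->
     gcos e (x + 2 * t) = gcos e t * (p * (1 + 2 * D) + 2 * D * q) /\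
     gsin e (x + 2 * t) = gsin e t * (q * (1 + 2 * D) + 2 * (1 + D) * p)).
  { intros x p q Hp Hq. rewrite gcos_plus, gsin_plus, Hp, Hq, H2c, H2s. split.
    - unfold D, dsym. ring.
    - rewrite <- Hc. ring. }
  assert (H1 : gcos e t = gcos e t * 1 /\ gsin e t = gsin e t * 1) by (split; ring).
  assert (H3 := step _ _ _ (proj1 H1) (proj2 H1)).
  assert (H5 := step _ _ _ (proj1 H3) (proj2 H3)).
  assert (H7 := step _ _ _ (proj1 H5) (proj2 H5)).
  assert (pos : forall x p q p' q' (y : Z),
     gcos e x = gcos e t * p /\ gsin e x = gsin e t * q ->
     x = t * IZR y -> p = p' -> q = q' ->
     gcos e (t * IZR y) = gcos e t * p' /\ gsin e (t * IZR y) = gsin e t * q').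
  { intros x p q p' q' z H <- <- <-. exact H. }
  assert (neg : forall x p q p' q' (y : Z),
     gcos e x = gcos e t * p /\ gsin e x = gsin e t * q ->
     - x = t * IZR y -> p = p' -> - q = q' ->
     gcos e (t * IZR y) = gcos e t * p' /\ gsin e (t * IZR y) = gsin e t * q').
  { intros x p q p' q' z [H H'] <- <- <-. rewrite gcos_opp, gsin_opp, H, H'.
    split; ring. }
  simpl. intros [<-|[<-|[<-|[<-|[<-|[<-|[<-|[]]]]]]]];
    [ apply (neg _ _ _ _ _ _ H5) | apply (neg _ _ _ _ _ _ H3)
    | apply (neg _ _ _ _ _ _ H1) | apply (pos _ _ _ _ _ _ H1)
    | apply (pos _ _ _ _ _ _ H3) | apply (pos _ _ _ _ _ _ H5)
    | apply (pos _ _ _ _ _ _ H7) ]; unfold rcos, rsin; simpl; ring.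
Qed.

(** The conditions of [moments] after cancelling (gsin t/t)^3 and the common factor gcos t or gsin
    t. The cosine condition keeps the right-hand side 4 D (t/gsin t)^3/gcos t = 4 D (1 + X D). *)
Record reduced_moments (D X : R) (s : Z) (n : nat) (c : nat -> R) : Prop := {
  rmoment_0 : sum_f_R0 c n = 0;
  rmoment_1 : sum_f_R0 (fun k => c k * node s k) n = 0;
  rmoment_2 : sum_f_R0 (fun k => c k * node s k ^ 2) n = 8;
  rmoment_cos :
    sum_f_R0 (fun k => c k * rcos D (2 * (s + Z.of_nat k) - 1)) n = 4 * D * (1 + X * D);
  rmoment_sin :
    sum_f_R0 (fun k => c k * rsin D (2 * (s + Z.of_nat k) - 1)) n = 0 }.

(** The bounds on s and n confine the odd offsets to -5, ..., 7, where the multiple-angle formulas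
    are available. *)
Lemma moments_reduce e t s n c :
  t <> 0 -> gsin e t <> 0 -> gcos e t <> 0 ->
  (-2 <= s)%Z -> (s + Z.of_nat n <= 4)%Z ->
  moments e t s n c -> reduced_moments (dsym e t) (xsym e t) s n c.
Proof.
  intros Ht Hs Hc Hs1 Hs2 [M0 M1 M2 Mc Ms].
  assert (HD : dsym e t <> 0).
  { unfold dsym. apply Rmult_integral_contrapositive_currified.
    - destruct e; simpl; lra.
    - now apply pow_nonzero. }
  assert (Hin : forall k, (k <= n)%nat ->
     In (2 * (s + Z.of_nat k) - 1)%Z [-5; -3; -1; 1; 3; 5; 7]%Z).
  { intros k Hk. assert (H : (-2 <= s + Z.of_nat k <= 4)%Z) by lia.
    cbn [In]. lia. }
  split; auto.
  - rewrite (sum_eq _ (fun k => c k * rcos (dsym e t) (2 * (s + Z.of_nat k) - 1)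
        * gcos e t)) in Mc.
    + rewrite <- scal_sum in Mc.
      apply (Rmult_eq_reg_l ((gsin e t / t) ^ 3 * gcos e t)).
      * rewrite Rmult_assoc, Mc.
        unfold xsym. set (D := dsym e t) in *.
        transitivity (4 * D); [unfold D, dsym; ring | field; auto].
      * apply Rmult_integral_contrapositive_currified; auto.
        apply pow_nonzero. unfold Rdiv. apply Rmult_integral_contrapositive_currified; auto.
        now apply Rinv_neq_0_compat.
    + intros k Hk. unfold node. rewrite (proj1 (odd_multiples e t _ (Hin k Hk))). ring.
  - rewrite (sum_eq _ (fun k => c k * rsin (dsym e t) (2 * (s + Z.of_nat k) - 1)
        * gsin e t)) in Ms.
    + rewrite <- scal_sum in Ms.
      apply Rmult_integral in Ms as [Ms|Ms].
      * exfalso. revert Ms.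
        apply pow_nonzero. unfold Rdiv. apply Rmult_integral_contrapositive_currified; auto.
        now apply Rinv_neq_0_compat.
      * apply Rmult_integral in Ms as [Ms|Ms]; tauto.
    + intros k Hk. unfold node. rewrite (proj2 (odd_multiples e t _ (Hin k Hk))). ring.
Qed.

(** * Solving the linear systems for the coefficients *)

(* The coefficients are second differences of numbers b_k with sum 1, for which
   the moment conditions become a linear system. *)
Lemma five_point_coefficients_0 D X c : D <> 0 -> reduced_moments D X (-2) 4 c ->
  c 0%nat = X / 4 /\
  c 1%nat + 2 * c 0%nat = (1 - X * (1 + D)) / 2 /\
  c 2%nat + 2 * c 1%nat + 3 * c 0%nat = (1 + X * (1 + 2 * D) / 2) / 2.
Proof.
  intros HD [M0 M1 M2 Mc Ms]. unfold node, rcos, rsin in *. simpl in *.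
  remember (c 0%nat) as b0 eqn:E0.
  remember (c 1%nat + 2 * b0) as b1 eqn:E1.
  remember (c 4%nat) as b2 eqn:E4.
  (* c is the second difference of (b0, b1, b2) extended by zero; the entries c 2 and c 3 follow
     from the moments of order 0 and 1. The left-hand sides of the conclusion are b0, b1, b2. *)
  assert (E1' : c 1%nat = b1 - 2 * b0) by lra.
  assert (E2 : c 2%nat = b2 - 2 * b1 + b0) by lra.
  assert (E3 : c 3%nat = b1 - 2 * b2) by lra.
  rewrite E1', E2, E3 in *.
  assert (Es : b1 = 1 - b0 - b2) by lra. rewrite Es in *.
  (* The cosine equation carries a factor D^2 and the sine equation a factor D; both cancel. *)
  assert (Hc : D * (D * (4 * b0 - X)) = 0) by lra.
  assert (Hs : D * (2 * b2 - 1 - b0 * (2 + 4 * D)) = 0) by lra.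
  apply Rmult_integral in Hc as [|Hc]; [contradiction|].
  apply Rmult_integral in Hc as [|Hc]; [contradiction|].
  apply Rmult_integral in Hs as [|Hs]; [contradiction|].
  assert (Hb : b0 = X / 4) by lra. rewrite Hb in Hs |- *.
  repeat split; lra.
Qed.

(** This stencil mirrors the previous one about the interface, so the b_k appear in reverse
    order. *)
Lemma five_point_coefficients_1 D X c : D <> 0 -> reduced_moments D X (-1) 4 c ->
  c 0%nat = (1 + X * (1 + 2 * D) / 2) / 2 /\
  c 1%nat + 2 * c 0%nat = (1 - X * (1 + D)) / 2.
Proof.
  intros HD [M0 M1 M2 Mc Ms]. unfold node, rcos, rsin in *. simpl in *.
  remember (c 0%nat) as b0 eqn:E0.
  remember (c 1%nat + 2 * b0) as b1 eqn:E1.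
  remember (c 4%nat) as b2 eqn:E4.
  assert (E1' : c 1%nat = b1 - 2 * b0) by lra.
  assert (E2 : c 2%nat = b2 - 2 * b1 + b0) by lra.
  assert (E3 : c 3%nat = b1 - 2 * b2) by lra.
  rewrite E1', E2, E3 in *.
  assert (Es : b1 = 1 - b0 - b2) by lra. rewrite Es in *.
  assert (Hc : D * (D * (4 * b2 - X)) = 0) by lra.
  assert (Hs : D * (2 * b0 - 1 - b2 * (2 + 4 * D)) = 0) by lra.
  apply Rmult_integral in Hc as [|Hc]; [contradiction|].
  apply Rmult_integral in Hc as [|Hc]; [contradiction|].
  apply Rmult_integral in Hs as [|Hs]; [contradiction|].
  assert (Hb : b2 = X / 4) by lra. rewrite Hb in Hs |- *.
  repeat split; lra.
Qed.

(** From the rightmost stencil only c 0, the divisor of d_2, enters the ideal weights. *)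
Lemma five_point_coefficients_2 D X c : D <> 0 -> reduced_moments D X 0 4 c ->
  c 0%nat = 1 - X / 4 + (2 + 4 * D) * (1 / 2 + X * (1 + 2 * D) / 4).
Proof.
  intros HD [M0 M1 M2 Mc Ms]. unfold node, rcos, rsin in *. simpl in *.
  remember (c 0%nat) as b0 eqn:E0.
  remember (c 1%nat + 2 * b0) as b1 eqn:E1.
  remember (c 4%nat) as b2 eqn:E4.
  assert (E1' : c 1%nat = b1 - 2 * b0) by lra.
  assert (E2 : c 2%nat = b2 - 2 * b1 + b0) by lra.
  assert (E3 : c 3%nat = b1 - 2 * b2) by lra.
  rewrite E1', E2, E3 in *.
  assert (Es : b0 = 1 - b1 - b2) by lra. rewrite Es in *.
  assert (Hc : D * (D * (4 * b1 + b2 * (12 + 16 * D) - X)) = 0) by lra.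
  assert (Hs : D * (b1 * (2 + 4 * D) + b2 * (4 + 20 * D + 16 * D ^ 2) + 1) = 0) by lra.
  apply Rmult_integral in Hc as [|Hc]; [contradiction|].
  apply Rmult_integral in Hc as [|Hc]; [contradiction|].
  apply Rmult_integral in Hs as [|Hs]; [contradiction|].
  assert (Hb1 : b1 = X / 4 - b2 * (3 + 4 * D)) by lra.
  rewrite Hb1 in Hs.
  assert (Hb2 : b2 = 1 / 2 + X * (1 + 2 * D) / 4) by lra.
  rewrite Hb1, Hb2. field.
Qed.

(** The five numbers b_k sit at the offsets -3, -1, 1, 3, 5. P and p are the sum and difference of
    the pair at 3 and -3, Q and q those of the pair at 1 and -1, and r is the value at 5.
    Subtracting the two cosine equations gives r as a divided difference of X; subtracting the two
    sine equations gives p. *)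
Lemma seven_point_coefficients D1 X1 D2 X2 c :
  D1 <> 0 -> D2 <> 0 -> D1 <> D2 ->
  reduced_moments D1 X1 (-2) 6 c -> reduced_moments D2 X2 (-2) 6 c ->
  let r := (X1 - X2) / (D1 - D2) / 16 in
  let P := (X1 - r * (12 + 16 * D1)) / 4 in
  let p := - r * (5 + 4 * (D1 + D2)) in
  let Q := 1 - P - r in
  let q := - (p * (3 + 4 * D1) + r * (5 + 20 * D1 + 16 * D1 ^ 2)) in
  c 0%nat = (P - p) / 2 /\
  c 1%nat + 2 * c 0%nat = (Q - q) / 2 /\
  c 2%nat + 2 * c 1%nat + 3 * c 0%nat = (Q + q) / 2.
Proof.
  intros HD1 HD2 HD [M0 M1 M2 Mc1 Ms1] [_ _ _ Mc2 Ms2].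
  unfold node, rcos, rsin in *. simpl in *.
  remember (c 0%nat) as b0 eqn:E0.
  remember (c 1%nat + 2 * b0) as b1 eqn:E1.
  remember (c 2%nat + 2 * c 1%nat + 3 * b0) as b2 eqn:E2.
  remember (c 6%nat) as r' eqn:E6.
  remember (c 5%nat + 2 * r') as b3 eqn:E5.
  assert (E1' : c 1%nat = b1 - 2 * b0) by lra.
  assert (E2' : c 2%nat = b2 - 2 * b1 + b0) by lra.
  assert (E3' : c 3%nat = b3 - 2 * b2 + b1) by lra.
  assert (E4' : c 4%nat = r' - 2 * b3 + b2) by lra.
  assert (E5' : c 5%nat = b3 - 2 * r') by lra.
  clear E0 E1 E2 E5 E6.
  rewrite E1', E2', E3', E4', E5' in *.
  assert (Es : b1 = 1 - b0 - b2 - b3 - r') by lra. rewrite Es in *.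
  assert (Hc1 : D1 * (D1 * (4 * (b0 + b3) + r' * (12 + 16 * D1) - X1)) = 0) by lra.
  assert (Hc2 : D2 * (D2 * (4 * (b0 + b3) + r' * (12 + 16 * D2) - X2)) = 0) by lra.
  assert (Hs1 : D1 * ((b3 - b0) * (3 + 4 * D1) + (2 * b2 + b0 + b3 + r' - 1)
      + r' * (5 + 20 * D1 + 16 * D1 ^ 2)) = 0) by lra.
  assert (Hs2 : D2 * ((b3 - b0) * (3 + 4 * D2) + (2 * b2 + b0 + b3 + r' - 1)
      + r' * (5 + 20 * D2 + 16 * D2 ^ 2)) = 0) by lra.
  apply Rmult_integral in Hc1 as [|Hc1]; [contradiction|].
  apply Rmult_integral in Hc1 as [|Hc1]; [contradiction|].
  apply Rmult_integral in Hc2 as [|Hc2]; [contradiction|].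
  apply Rmult_integral in Hc2 as [|Hc2]; [contradiction|].
  apply Rmult_integral in Hs1 as [|Hs1]; [contradiction|].
  apply Rmult_integral in Hs2 as [|Hs2]; [contradiction|].
  assert (Hr : r' = (X1 - X2) / (D1 - D2) / 16).
  { replace (X1 - X2) with (16 * r' * (D1 - D2)) by lra. field. lra. }
  assert (Hp : (D1 - D2) * (b3 - b0 + r' * (5 + 4 * (D1 + D2))) = 0) by lra.
  apply Rmult_integral in Hp as [|Hp]; [lra|].
  rewrite <- Hr. cbv zeta.
  assert (HP : b0 + b3 = (X1 - r' * (12 + 16 * D1)) / 4) by lra.
  assert (Hp' : b3 - b0 = - r' * (5 + 4 * (D1 + D2))) by lra.
  rewrite <- HP, <- Hp'. repeat split; lra.
Qed.

(** * The ideal weights sum to 1 *)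

(** By the choice of the d_m, the seven-point coefficients minus the weighted five-point ones vanish
    at the first three points. The four remaining entries and the defect sigma = 1 - d_0 - d_1 - d_2
    solve a homogeneous system. Elimination leaves sigma times the quantity assumed nonzero, whose
    limit is 7 as D tends to 0 and X to -1. *)
Lemma ideal_weight_sum D X c7 c5 :
  D <> 0 -> X * (1 + 8 * D + 8 * D ^ 2) + 8 + 8 * D <> 0 ->
  reduced_moments D X (-2) 6 c7 ->
  (forall m, (m <= 2)%nat -> reduced_moments D X (-2 + Z.of_nat m) 4 (c5 m)) ->
  (forall m, (m <= 2)%nat -> c5 m 0%nat <> 0) ->
  sum_f_R0 (ideal_weight c7 c5) 2 = 1.
Proof.
  intros HD HX H7 H5 Hne.
  pose proof (Hne 0%nat ltac:(lia)) as N0. pose proof (Hne 1%nat ltac:(lia)) as N1.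
  pose proof (Hne 2%nat ltac:(lia)) as N2.
  pose proof (H5 0%nat ltac:(lia)) as [A0 A1 A2 Ac As].
  pose proof (H5 1%nat ltac:(lia)) as [B0 B1 B2 Bc Bs].
  pose proof (H5 2%nat ltac:(lia)) as [C0 C1 C2 Cc Cs].
  destruct H7 as [M0 M1 M2 Mc Ms]. clear H5 Hne.
  unfold ideal_weight, node, rcos, rsin in *. simpl in *.
  remember (c7 0%nat / c5 0%nat 0%nat) as d0 eqn:E0.
  remember ((c7 1%nat - d0 * c5 0%nat 1%nat) / c5 1%nat 0%nat) as d1 eqn:E1.
  remember ((c7 2%nat - d0 * c5 0%nat 2%nat - d1 * c5 1%nat 1%nat) / c5 2%nat 0%nat)
    as d2 eqn:E2.
  assert (F0 : c7 0%nat = d0 * c5 0%nat 0%nat) by (rewrite E0; field; auto).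
  assert (F1 : c7 1%nat = d0 * c5 0%nat 1%nat + d1 * c5 1%nat 0%nat)
    by (rewrite E1; field; auto).
  assert (F2 : c7 2%nat = d0 * c5 0%nat 2%nat + d1 * c5 1%nat 1%nat
     + d2 * c5 2%nat 0%nat) by (rewrite E2; field; auto).
  clear E0 E1 E2. rewrite F0, F1, F2 in *.
  (* The error 1 - d0 - d1 - d2 would be the sum of a two-point rule, supported
     on the last two second differences, that is still exact. *)
  remember (c7 3%nat - d0 * c5 0%nat 3%nat - d1 * c5 1%nat 2%nat - d2 * c5 2%nat 1%nat)
    as e3 eqn:E3.
  remember (c7 4%nat - d0 * c5 0%nat 4%nat - d1 * c5 1%nat 3%nat - d2 * c5 2%nat 2%nat)
    as e4 eqn:E4.
  remember (c7 5%nat - d1 * c5 1%nat 4%nat - d2 * c5 2%nat 3%nat) as e5 eqn:E5.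
  remember (c7 6%nat - d2 * c5 2%nat 4%nat) as g eqn:E6.
  assert (combine : forall l7 l50 l51 l52 r7 r50 r51 r52, l7 = r7 -> l50 = r50 ->
     l51 = r51 -> l52 = r52 -> l7 - d0 * l50 - d1 * l51 - d2 * l52
     = r7 - d0 * r50 - d1 * r51 - d2 * r52) by (intros; subst; ring).
  pose proof (combine _ _ _ _ _ _ _ _ M0 A0 B0 C0) as G0.
  pose proof (combine _ _ _ _ _ _ _ _ M1 A1 B1 C1) as G1.
  pose proof (combine _ _ _ _ _ _ _ _ M2 A2 B2 C2) as G2.
  pose proof (combine _ _ _ _ _ _ _ _ Mc Ac Bc Cc) as Gc.
  pose proof (combine _ _ _ _ _ _ _ _ Ms As Bs Cs) as Gs.
  replace (c7 3%nat) with (e3 + d0 * c5 0%nat 3%nat + d1 * c5 1%nat 2%nat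
    + d2 * c5 2%nat 1%nat) in * by lra.
  replace (c7 4%nat) with (e4 + d0 * c5 0%nat 4%nat + d1 * c5 1%nat 3%nat
    + d2 * c5 2%nat 2%nat) in * by lra.
  replace (c7 5%nat) with (e5 + d1 * c5 1%nat 4%nat + d2 * c5 2%nat 3%nat) in * by lra.
  replace (c7 6%nat) with (g + d2 * c5 2%nat 4%nat) in * by lra.
  clear M0 M1 M2 Mc Ms A0 A1 A2 Ac As B0 B1 B2 Bc Bs C0 C1 C2 Cc Cs E3 E4 E5 E6
    F0 F1 F2 combine.
  remember (1 - d0 - d1 - d2) as sigma eqn:Esigma.
  assert (K0 : e3 + e4 + e5 + g = 0) by lra.
  assert (K1 : e3 + 3 * e4 + 5 * e5 + 7 * g = 0) by lra.
  assert (K2 : e3 + 9 * e4 + 25 * e5 + 49 * g = 8 * sigma) by lra.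
  assert (Kc : e3 + (1 + 4 * D) * e4 + (1 + 12 * D + 16 * D ^ 2) * e5
     + (1 + 24 * D + 80 * D ^ 2 + 64 * D ^ 3) * g = 4 * D * (1 + X * D) * sigma).
  { rewrite Esigma. lra. }
  assert (Ks : e3 + (3 + 4 * D) * e4 + (5 + 20 * D + 16 * D ^ 2) * e5
     + (7 + 56 * D + 112 * D ^ 2 + 64 * D ^ 3) * g = 0) by lra.
  clear G0 G1 G2 Gc Gs.
  assert (e3 = sigma - g) by lra. assert (e4 = 3 * g - 2 * sigma) by lra.
  assert (e5 = sigma - 3 * g) by lra. subst e3 e4 e5.
  assert (L1 : D * (D * (g * (8 + 16 * D) - sigma * (X - 4))) = 0) by lra.
  assert (L2 : D * (sigma * (3 + 4 * D) + g * (2 + 16 * D + 16 * D ^ 2)) = 0) by lra.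
  apply Rmult_integral in L1 as [|L1]; [contradiction|].
  apply Rmult_integral in L1 as [|L1]; [contradiction|].
  apply Rmult_integral in L2 as [|L2]; [contradiction|].
  (* Cramer's rule for the two equations in sigma and g: g is eliminated. *)
  assert (L : sigma * (X * (1 + 8 * D + 8 * D ^ 2) + 8 + 8 * D) = 0).
  { transitivity ((8 + 16 * D)
        * (sigma * (3 + 4 * D) + g * (2 + 16 * D + 16 * D ^ 2)) / 2
      - (2 + 16 * D + 16 * D ^ 2) * (g * (8 + 16 * D) - sigma * (X - 4)) / 2).
    - field.
    - rewrite L1, L2. field. }
  apply Rmult_integral in L as [L|L]; [lra | contradiction].
Qed.

(** * Weight errors and the size of the global indicator *)

(** As beta_j >= 0, every z_j lies between 0 and zeta/h^2. The smallness hypothesis keeps 1 + T >=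
    1/2, whence the factor 2 in the bound. *)
Lemma omega_error (d : nat -> R) (V : Z -> R) (h K : R) (m : nat) :
  0 < h -> (m <= 2)%nat -> sum_f_R0 d 2 = 1 ->
  (forall j, (j <= 2)%nat -> Rabs (d j) <= K) ->
  3 * K * (zeta V / h ^ 2) <= / 2 ->
  Rabs (omega d V h m - d m) <= 2 * K * (1 + 3 * K) * (zeta V / h ^ 2).
Proof.
  intros Hh Hm Hsum Hd HZ. set (Z := zeta V / h ^ 2) in *.
  assert (Hh2 : 0 < h ^ 2) by (apply pow_lt; auto).
  set (z := fun j => zeta V / (beta V j + h ^ 2)).
  assert (Hz : forall j, 0 <= z j <= Z).
  { intros j. assert (0 <= beta V j)
      by (unfold beta; apply Rplus_le_le_0_compat; apply Rabs_pos).
    assert (0 <= zeta V) by apply Rabs_pos.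
    unfold z, Z, Rdiv. split.
    - apply Rmult_le_pos; auto. apply Rlt_le, Rinv_0_lt_compat. lra.
    - apply Rmult_le_compat_l; auto. apply Rinv_le_contravar; lra. }
  assert (Hdz : forall j, (j <= 2)%nat -> Rabs (d j * z j) <= K * Z).
  { intros j Hj. rewrite Rabs_mult.
    apply Rmult_le_compat; try apply Rabs_pos; auto.
    rewrite Rabs_pos_eq; apply Hz. }
  set (T := d 0%nat * z 0%nat + d 1%nat * z 1%nat + d 2%nat * z 2%nat).
  assert (HT : Rabs T <= 3 * K * Z).
  { pose proof (Hdz 0%nat ltac:(lia)). pose proof (Hdz 1%nat ltac:(lia)).
    pose proof (Hdz 2%nat ltac:(lia)). unfold T.
    pose proof (Rabs_triang (d 0%nat * z 0%nat + d 1%nat * z 1%nat) (d 2%nat * z 2%nat)).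
    pose proof (Rabs_triang (d 0%nat * z 0%nat) (d 1%nat * z 1%nat)). lra. }
  assert (HT' : - / 2 <= T) by (apply Rabs_le_between in HT; lra).
  assert (Halpha : sum_f_R0 (alpha d V h) 2 = 1 + T).
  { rewrite <- Hsum. unfold alpha, T, z. simpl. ring. }
  unfold omega. rewrite Halpha. unfold alpha. fold (z m).
  replace (d m * (1 + z m) / (1 + T) - d m) with (d m * (z m - T) / (1 + T))
    by (field; lra).
  pose proof (Hd m Hm) as Hdm. pose proof (Hz m) as Hzm.
  pose proof (Rabs_pos (d m)) as HK.
  unfold Rdiv. rewrite !Rabs_mult, Rabs_inv, (Rabs_pos_eq (1 + T)) by lra.
  assert (Hdiff : Rabs (z m - T) <= Z + 3 * K * Z).
  { apply Rle_trans with (1 := Rabs_triang _ _).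
    rewrite Rabs_Ropp, (Rabs_pos_eq (z m)) by lra. lra. }
  assert (/ (1 + T) <= 2).
  { replace 2 with (/ / 2) by field. apply Rinv_le_contravar; lra. }
  replace (2 * K * (1 + 3 * K) * Z) with (K * (Z + 3 * K * Z) * 2) by ring.
  apply Rmult_le_compat; auto.
  - apply Rmult_le_pos; apply Rabs_pos.
  - apply Rlt_le, Rinv_0_lt_compat; lra.
  - apply Rmult_le_compat; auto; apply Rabs_pos.
Qed.

(* The differences entering [zeta] at the two outer stencils agree up to fifth
   differences, which do not see a quartic polynomial. *)
Lemma zeta_quartic (V : Z -> R) (a0 a1 a2 a3 a4 y E : R) :
  (forall j, (-2 <= j <= 4)%Z ->
     Rabs (V j - (a0 + a1 * (y + IZR j) + a2 * (y + IZR j) ^ 2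
                  + a3 * (y + IZR j) ^ 3 + a4 * (y + IZR j) ^ 4)) <= E) ->
  zeta V <= 64 * E.
Proof.
  intros H.
  set (P := fun j : Z => a0 + a1 * (y + IZR j) + a2 * (y + IZR j) ^ 2
                  + a3 * (y + IZR j) ^ 3 + a4 * (y + IZR j) ^ 4).
  remember (fun j => V j - P j) as e eqn:Ee.
  assert (He : forall j, (-2 <= j <= 4)%Z -> - E <= e j <= E).
  { intros j Hj. rewrite Ee. apply Rabs_le_between. exact (H j Hj). }
  assert (HV : forall j, V j = P j + e j) by (intros; rewrite Ee; ring).
  assert (Hdiff : zeta V <= Rabs (D3 V 0 - D3 V 2) + Rabs (D4 V 0 - D4 V 2)).
  { unfold zeta, beta.
    replace (Rabs (D3 V 0) + Rabs (D4 V 0) - (Rabs (D3 V 2) + Rabs (D4 V 2)))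
      with ((Rabs (D3 V 0) - Rabs (D3 V 2)) + (Rabs (D4 V 0) - Rabs (D4 V 2))) by ring.
    apply Rle_trans with (1 := Rabs_triang _ _).
    apply Rplus_le_compat; apply Rabs_triang_inv2. }
  pose proof (He (-2)%Z ltac:(lia)). pose proof (He (-1)%Z ltac:(lia)).
  pose proof (He 0%Z ltac:(lia)). pose proof (He 1%Z ltac:(lia)).
  pose proof (He 2%Z ltac:(lia)). pose proof (He 3%Z ltac:(lia)).
  pose proof (He 4%Z ltac:(lia)).
  (* This is a single fifth difference; its coefficients have absolute sum 32. *)
  assert (Rabs (D3 V 0 - D3 V 2) <= 32 * E).
  { replace (D3 V 0 - D3 V 2) with
      (- e (-1)%Z + 5 * e 0%Z - 10 * e 1%Z + 10 * e 2%Z - 5 * e 3%Z + e 4%Z).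
    - apply Rabs_le. lra.
    - simpl. rewrite !HV. unfold P. ring. }
  (* Up to sign, the sum of two consecutive fifth differences; the absolute sum of the coefficients
     is 20, below 32. *)
  assert (Rabs (D4 V 0 - D4 V 2) <= 32 * E).
  { replace (D4 V 0 - D4 V 2) with
      (e (-2)%Z - 4 * e (-1)%Z + 5 * e 0%Z - 5 * e 2%Z + 4 * e 3%Z - e 4%Z).
    - apply Rabs_le. lra.
    - unfold D4. simpl. rewrite !HV. unfold P. ring. }
  lra.
Qed.

Lemma smooth_third_derivative_all v a b : smooth_third_derivative v a b ->
  forall n x, a < x < b -> ex_derive_n v n x.
Proof.
  intros [Hlow Hhigh] n x Hx. destruct (Nat.le_gt_cases n 3) as [Hn|Hn]; auto.
  pose proof (Hhigh (n - 3)%nat x Hx) as H.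
  (* [ex_derive_n] reduces to [ex_derive] only at a visible successor, hence the index n - 4. *)
  replace n with (S (n - 4 + 3)) by lia.
  replace (n - 3)%nat with (S (n - 4)) in H by lia.
  change (ex_derive (Derive_n (Derive_n v 3) (n - 4)) x) in H.
  change (ex_derive (Derive_n v (n - 4 + 3)) x).
  revert H. apply ex_derive_ext. intros t. apply Derive_n_comp.
Qed.

(** Taylor expansion with Lagrange remainder about xi - 4h, which lies to the left of every grid
    point, so the offsets are j + 4. Starting at j = -3 serves both interfaces. *)
Lemma grid_values_quartic v a b xi : a < xi < b -> smooth_third_derivative v a b ->
  exists K, at_right 0 (fun h => exists a0 a1 a2 a3 a4,
    forall j, (-3 <= j <= 4)%Z ->
    Rabs (grid_values v xi h j - (a0 + a1 * (IZR j + 4) + a2 * (IZR j + 4) ^ 2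
                  + a3 * (IZR j + 4) ^ 3 + a4 * (IZR j + 4) ^ 4)) <= K * h ^ 5).
Proof.
  intros Hxi Hv. pose proof (smooth_third_derivative_all v a b Hv) as Hn.
  assert (Hc : continuous (Derive_n v 5) xi).
  { apply (ex_derive_continuous (Derive_n v 5) xi). exact (Hn 6%nat xi Hxi). }
  set (L := Rabs (Derive_n v 5 xi) + 1).
  assert (Hloc : locally xi (fun x => Rabs (Derive_n v 5 x) <= L)).
  { assert (Hball := Hc _ (locally_ball (Derive_n v 5 xi) (mkposreal 1 Rlt_0_1))).
    unfold filtermap in Hball. revert Hball. apply filter_imp. intros x Hx.
    change (Rabs (Derive_n v 5 x - Derive_n v 5 xi) < 1) in Hx. unfold L.
    pose proof (Rabs_triang_inv (Derive_n v 5 x) (Derive_n v 5 xi)). lra. }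
  destruct Hloc as [delta Hdelta].
  (* The offsets are at most 8h, and the factor 1/5! is dropped. *)
  exists (L * 8 ^ 5).
  (* All points used lie within 4h of xi; dividing by 5 keeps them inside both neighbourhoods. *)
  set (rho := Rmin (delta / 5) (Rmin ((xi - a) / 5) ((b - xi) / 5))).
  assert (Hrho : 0 < rho).
  { pose proof (cond_pos delta). unfold rho.
    repeat apply Rmin_glb_lt; lra. }
  exists (mkposreal _ Hrho). intros h Hh Hpos.
  assert (Hh' : h < rho).
  { change (Rabs (h + - 0) < rho) in Hh. rewrite Ropp_0, Rplus_0_r in Hh.
    rewrite Rabs_pos_eq in Hh; lra. }
  assert (h < delta / 5 /\ h < (xi - a) / 5 /\ h < (b - xi) / 5) as [H1 [H2 H3]].
  { pose proof (Rmin_l (delta / 5) (Rmin ((xi - a) / 5) ((b - xi) / 5))).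
    pose proof (Rmin_r (delta / 5) (Rmin ((xi - a) / 5) ((b - xi) / 5))).
    pose proof (Rmin_l ((xi - a) / 5) ((b - xi) / 5)).
    pose proof (Rmin_r ((xi - a) / 5) ((b - xi) / 5)).
    unfold rho in Hh'. lra. }
  set (x0 := xi - 4 * h). set (f := fun m => h ^ m / INR (fact m) * Derive_n v m x0).
  exists (f 0%nat), (f 1%nat), (f 2%nat), (f 3%nat), (f 4%nat). intros j Hj.
  assert (HJ : 1 <= IZR j + 4 <= 8).
  { destruct Hj as [Hl Hr]. apply IZR_le in Hl. apply IZR_le in Hr. lra. }
  assert (Hlt : x0 < xi + IZR j * h <= xi + 4 * h) by (unfold x0; nra).
  destruct (Taylor_Lagrange v 4 x0 (xi + IZR j * h)) as [c [Hcin Hc5]].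
  - apply Hlt.
  - intros t Ht k _. apply Hn. unfold x0 in *. lra.
  - unfold grid_values. rewrite Hc5.
    replace (xi + IZR j * h - x0) with ((IZR j + 4) * h) by (unfold x0; ring).
    match goal with |- Rabs ?e <= _ =>
      replace e with (((IZR j + 4) * h) ^ 5 / INR (fact 5) * Derive_n v 5 c) end.
    2: { unfold f. simpl sum_f_R0. rewrite !Rpow_mult_distr. simpl. field. }
    assert (Hcb : Rabs (Derive_n v 5 c) <= L).
    { apply Hdelta. change (Rabs (c + - xi) < delta).
      unfold x0 in *. apply Rabs_lt_between. lra. }
    assert (Hp : 0 <= ((IZR j + 4) * h) ^ 5 <= (8 * h) ^ 5).
    { split; [apply pow_le; nra | apply pow_incr; nra]. }
    rewrite Rabs_mult, (Rabs_pos_eq (_ / _)).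
    2: { apply Rdiv_le_0_compat; [lra | apply INR_fact_lt_0]. }
    replace (L * 8 ^ 5 * h ^ 5) with ((8 * h) ^ 5 * L) by (rewrite Rpow_mult_distr; ring).
    apply Rmult_le_compat; auto.
    + apply Rdiv_le_0_compat; [lra | apply INR_fact_lt_0].
    + apply Rabs_pos.
    + apply Rle_trans with (2 := proj2 Hp).
      apply Rle_div_l; [apply INR_fact_lt_0|].
      assert (1 <= INR (fact 5)) by (apply (le_INR 1), lt_O_fact).
      nra.
Qed.

Lemma zeta_order_5 v a b xi : a < xi < b -> smooth_third_derivative v a b ->
  exists K, at_right 0 (fun h => zeta (grid_values v xi h) <= K * h ^ 5 /\
     zeta (fun j => grid_values v xi h (j - 1)%Z) <= K * h ^ 5).
Proof.
  intros Hxi Hv. destruct (grid_values_quartic v a b xi Hxi Hv) as [K HK].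
  exists (64 * K). revert HK. apply filter_imp.
  intros h [a0 [a1 [a2 [a3 [a4 H]]]]]. rewrite Rmult_assoc.
  split.
  - apply (zeta_quartic _ a0 a1 a2 a3 a4 4). intros j Hj.
    rewrite (Rplus_comm 4). apply H. lia.
  - apply (zeta_quartic _ a0 a1 a2 a3 a4 3). intros j Hj.
    replace (3 + IZR j) with (IZR (j - 1) + 4) by (rewrite minus_IZR; ring).
    apply H. lia.
Qed.

(** * Ideal weights for small h *)

Lemma scaled_to_punctured (k : R) : k <> 0 ->
  filterlim (fun h => k * h / 2) (at_right 0) (locally' 0).
Proof.
  intros Hk P [delta Hdelta].
  assert (Hpos : 0 < delta / Rabs k).
  { apply Rdiv_lt_0_compat; [apply cond_pos | now apply Rabs_pos_lt]. }
  exists (mkposreal _ Hpos). intros h Hh Hh0.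
  change (Rabs (h + - 0) < delta / Rabs k) in Hh.
  rewrite Ropp_0, Rplus_0_r in Hh.
  apply Rlt_div_r in Hh; [|now apply Rabs_pos_lt].
  rewrite <- Rabs_mult in Hh. pose proof (Rabs_pos (h * k)).
  apply Hdelta.
  - change (Rabs (k * h / 2 + - 0) < delta). rewrite Ropp_0, Rplus_0_r.
    replace (k * h / 2) with (h * k * / 2) by field.
    rewrite Rabs_mult, (Rabs_pos_eq (/ 2)) by lra. lra.
  - unfold Rdiv. repeat apply Rmult_integral_contrapositive_currified; lra.
Qed.

Lemma xsym_near_0 e : locally' 0 (fun t => Rabs (xsym e t + 1) <= / 100).
Proof.
  destruct (symbols_near_0 e) as [[K HK] _].
  (* For |t| <= 1, t^2 <= |t|, so |X + 1| <= K t^2 is controlled by (|K| + 1) |t| <= 1/100. *)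
  set (delta := Rmin 1 (/ (100 * (Rabs K + 1)))).
  pose proof (Rabs_pos K) as HK0.
  assert (Hi : 0 < / (100 * (Rabs K + 1))) by (apply Rinv_0_lt_compat; lra).
  assert (Hd : 0 < delta) by (unfold delta; apply Rmin_glb_lt; lra).
  generalize (filter_and _ _ HK (punctured_small delta Hd)).
  apply filter_imp. intros t [H [Ht0 Ht]].
  assert (Ht1 : Rabs t <= 1).
  { pose proof (Rmin_l 1 (/ (100 * (Rabs K + 1)))). unfold delta in Ht. lra. }
  assert (Ht2 : (Rabs K + 1) * Rabs t <= / 100).
  { pose proof (Rmin_r 1 (/ (100 * (Rabs K + 1)))).
    replace (/ 100) with ((Rabs K + 1) * / (100 * (Rabs K + 1))) by (field; lra).
    apply Rmult_le_compat_l; [lra|]. unfold delta in Ht. lra. }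
  assert (t <> 0) by (intros ->; rewrite Rabs_R0 in Ht0; lra).
  replace (xsym e t + 1) with ((xsym e t + 1) / t ^ 2 * t ^ 2) by (field; auto).
  rewrite Rabs_mult, <- RPow_abs.
  pose proof (Rle_abs K). pose proof (Rabs_pos ((xsym e t + 1) / t ^ 2)).
  assert (Rabs t ^ 2 <= Rabs t) by nra.
  nra.
Qed.

Lemma symbols_at_right e k : k <> 0 ->
  bounded (at_right 0) (fun h => (xsym e (k * h / 2) + 1) / (k * h / 2) ^ 2) /\
  at_right 0 (fun h => gcos e (k * h / 2) <> 0 /\
    k * h / 2 / 2 * (k * h / 2 / 2) <= gsin e (k * h / 2) ^ 2 <= / 100 /\
    Rabs (xsym e (k * h / 2) + 1) <= / 100).
Proof.
  intros Hk. pose proof (scaled_to_punctured k Hk) as Hlim.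
  destruct (symbols_near_0 e) as [HB HE]. split.
  - exact (bounded_comp _ _ _ _ Hlim HB).
  - assert (H := filter_and _ _ (Hlim _ HE) (Hlim _ (xsym_near_0 e))).
    unfold filtermap in H. revert H. apply filter_imp. tauto.
Qed.

Lemma at_right_pos : at_right 0 (fun h => 0 < h).
Proof. exists (mkposreal 1 Rlt_0_1). auto. Qed.

(** Both X are -1 + O(t^2), so their difference is O(t^2), while sinh^2 t + sin^2 t >= t^2/2. *)
Lemma dsym_difference_ratio_bounded k : k <> 0 ->
  bounded (at_right 0) (fun h =>
    (xsym true (k * h / 2) - xsym false (k * h / 2))
    / (dsym true (k * h / 2) - dsym false (k * h / 2))).
Proof.
  intros Hk.
  destruct (symbols_at_right true k Hk) as [B1 E1].
  destruct (symbols_at_right false k Hk) as [B2 E2].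
  assert (HE := filter_and _ _ at_right_pos (filter_and _ _ E1 E2)).
  set (t := fun h => k * h / 2).
  assert (Hne : at_right 0 (fun h => 0 < t h ^ 2 /\ t h <> 0 /\
     t h ^ 2 / 2 <= dsym true (t h) - dsym false (t h))).
  { revert HE. apply filter_imp. intros h [Hh [[_ [H1 _]] [_ [H2 _]]]].
    assert (t h <> 0).
    { unfold t, Rdiv. repeat apply Rmult_integral_contrapositive_currified; lra. }
    split; [now apply pow2_gt_0|]. split; [assumption|].
    unfold dsym; simpl eps. fold (t h) in H1, H2. lra. }
  apply bounded_ext with (fun h =>
    ((xsym true (t h) + 1) / t h ^ 2 - (xsym false (t h) + 1) / t h ^ 2)
    / ((dsym true (t h) - dsym false (t h)) / t h ^ 2)).
  - exact _.
  - revert Hne. apply filter_imp. intros h [H1 [H2 H3]]. fold (t h). field. lra.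
  - apply bounded_div with (/ 2); [exact _ | lra | | unfold t; bounded].
    revert Hne. apply filter_imp. intros h [H1 [H2 H3]].
    assert (/ 2 <= (dsym true (t h) - dsym false (t h)) / t h ^ 2)
      by (apply Rle_div_r; lra).
    rewrite Rabs_pos_eq; lra.
Qed.

Lemma ideal_weight_asymptotics (e : bool) (k : R) (c7 : R -> nat -> R)
    (c5 : R -> nat -> nat -> R) :
  k <> 0 ->
  at_right 0 (fun h => flux_coefficients (Gamma7 (parameter e k)) h (-2) 6 (c7 h)) ->
  at_right 0 (fun h => forall m : nat, (m <= 2)%nat ->
    flux_coefficients (Gamma5 (parameter e k)) h (-2 + Z.of_nat m) 4 (c5 h m)) ->
  at_right 0 (fun h => sum_f_R0 (ideal_weight (c7 h) (c5 h)) 2 = 1) /\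
  forall m, bounded (at_right 0) (fun h => ideal_weight (c7 h) (c5 h) m).
Proof.
  intros Hk H7 H5.
  set (D := fun e h => dsym e (k * h / 2)). set (X := fun e h => xsym e (k * h / 2)).
  assert (Hsym : forall e, at_right 0 (fun h =>
     k * h / 2 <> 0 /\ gsin e (k * h / 2) <> 0 /\ gcos e (k * h / 2) <> 0 /\
     0 < eps e * D e h /\ Rabs (D e h) <= / 100 /\ Rabs (X e h + 1) <= / 100)).
  { intros e'. destruct (symbols_at_right e' k Hk) as [_ E].
    generalize (filter_and _ _ at_right_pos E). apply filter_imp.
    intros h [Hh [Hc [[Hl Hu] HX]]].
    assert (Ht : k * h / 2 <> 0).
    { unfold Rdiv. repeat apply Rmult_integral_contrapositive_currified; lra. }
    assert (Ht2 : 0 < k * h / 2 / 2 * (k * h / 2 / 2)) by nra.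
    assert (Hs : gsin e' (k * h / 2) <> 0).
    { intros Hs. rewrite Hs in Hl. lra. }
    unfold D, dsym. repeat split; auto; destruct e'; simpl eps; try lra; apply Rabs_le; lra. }
  (* The seven-point coefficients satisfy the conditions of both kinds, the five-point ones only
     those of the kind [e] of [lambda]. *)
  assert (HR : at_right 0 (fun h => D true h <> D false h /\ D e h <> 0 /\
     (forall e', D e' h <> 0 /\ Rabs (D e' h) <= / 100 /\ Rabs (X e' h + 1) <= / 100) /\
     (forall e', reduced_moments (D e' h) (X e' h) (-2) 6 (c7 h)) /\
     (forall m, (m <= 2)%nat ->
        reduced_moments (D e h) (X e h) (-2 + Z.of_nat m) 4 (c5 h m)))).
  { generalize (filter_and _ _ (filter_and _ _ H7 H5)
      (filter_and _ _ at_right_pos (filter_and _ _ (Hsym true) (Hsym false)))).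
    apply filter_imp. intros h [[F7 F5] [Hh [St Sf]]]. simpl eps in St, Sf.
    assert (S : forall e', k * h / 2 <> 0 /\ gsin e' (k * h / 2) <> 0 /\
       gcos e' (k * h / 2) <> 0 /\
       D e' h <> 0 /\ Rabs (D e' h) <= / 100 /\ Rabs (X e' h + 1) <= / 100).
    { intros e'. destruct e'; [destruct St as (?&?&?&?&?&?) | destruct Sf as (?&?&?&?&?&?)];
        repeat split; auto; lra. }
    split; [lra|]. split; [apply S|]. split; [intros; apply S|]. split.
    - intros e'. destruct (S e') as (?&?&?&_).
      apply moments_reduce; auto; try lia.
      apply (flux_coefficients_moments (Gamma7 (parameter e k))); auto; [lra|].
      intros q. apply Gamma7_span.
    - intros m Hm. destruct (S e) as (?&?&?&_).
      apply moments_reduce; auto; try lia.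
      apply (flux_coefficients_moments (Gamma5 (parameter e k))); auto; [lra|].
      intros q. apply Gamma5_span. }
  (* The three divisors tend to -1/4, 1/4 and 7/4, and the last expression to 7. *)
  assert (Hden : at_right 0 (fun h =>
     / 8 <= Rabs (c5 h 0%nat 0%nat) /\ / 8 <= Rabs (c5 h 1%nat 0%nat) /\
     / 8 <= Rabs (c5 h 2%nat 0%nat) /\
     X e h * (1 + 8 * D e h + 8 * D e h ^ 2) + 8 + 8 * D e h <> 0)).
  { revert HR. apply filter_imp. intros h (_ & HD & Hsm & _ & R5).
    destruct (Hsm e) as (_ & HDs & HXs).
    apply Rabs_le_between in HDs. apply Rabs_le_between in HXs.
    destruct (five_point_coefficients_0 _ _ _ HD (R5 0%nat ltac:(lia))) as [-> _].
    destruct (five_point_coefficients_1 _ _ _ HD (R5 1%nat ltac:(lia))) as [-> _].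
    rewrite (five_point_coefficients_2 _ _ _ HD (R5 2%nat ltac:(lia))).
    set (y := D e h) in *. set (x := X e h) in *.
    assert (- / 50 <= x * y <= / 50) by nra.
    assert (0 <= y * y <= / 50) by nra.
    assert (- / 50 <= x * y * y <= / 50) by nra.
    repeat split.
    - rewrite Rabs_left; lra.
    - rewrite Rabs_pos_eq; lra.
    - rewrite Rabs_pos_eq; lra.
    - intros ?. lra. }
  split.
  - generalize (filter_and _ _ HR Hden). apply filter_imp.
    intros h [(_ & HD & Hsm & R7 & R5) (N0 & N1 & N2 & HX)].
    apply (ideal_weight_sum (D e h) (X e h)); auto.
    intros m Hm Hz. destruct m as [|[|[|]]]; [ | | | lia];
      rewrite Hz, Rabs_R0 in *; lra.
  - assert (BD : forall e', bounded (at_right 0) (D e')).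
    { intros e'. exists (/ 100). revert HR. apply filter_imp. intros h (_&_&H&_). apply H. }
    assert (BX : forall e', bounded (at_right 0) (X e')).
    { intros e'. exists 2. revert HR. apply filter_imp. intros h (_&_&H&_).
      destruct (H e') as (_&_&H'). apply Rabs_le_between in H'. apply Rabs_le. lra. }
    set (r := fun h => (X true h - X false h) / (D true h - D false h)).
    assert (Br : bounded (at_right 0) r) by (apply dsym_difference_ratio_bounded; auto).
    assert (HBt := BD true). assert (HBf := BD false). assert (HXt := BX true).
    specialize (BD e). specialize (BX e).
    (* The quantities of [seven_point_coefficients]; the factor 1/16 is here kept outside r. *)
    pose (P := fun h => (X true h - r h / 16 * (12 + 16 * D true h)) / 4).
    pose (p := fun h => - (r h / 16) * (5 + 4 * (D true h + D false h))).
    pose (Q := fun h => 1 - P h - r h / 16).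
    pose (q := fun h => - (p h * (3 + 4 * D true h)
       + r h / 16 * (5 + 20 * D true h + 16 * D true h ^ 2))).
    assert (BP : bounded (at_right 0) P) by (unfold P; bounded).
    assert (Bp : bounded (at_right 0) p) by (unfold p; bounded).
    assert (BQ : bounded (at_right 0) Q) by (unfold Q; bounded).
    assert (Bq : bounded (at_right 0) q) by (unfold q; bounded).
    assert (C7 : at_right 0 (fun h => c7 h 0%nat = (P h - p h) / 2 /\
      c7 h 1%nat + 2 * c7 h 0%nat = (Q h - q h) / 2 /\
      c7 h 2%nat + 2 * c7 h 1%nat + 3 * c7 h 0%nat = (Q h + q h) / 2)).
    { revert HR. apply filter_imp. intros h (Hne & _ & Hsm & R7 & _).
      exact (seven_point_coefficients _ _ _ _ _ (proj1 (Hsm true)) (proj1 (Hsm false))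
        Hne (R7 true) (R7 false)). }
    assert (C5 : at_right 0 (fun h => c5 h 0%nat 0%nat = X e h / 4 /\
      c5 h 0%nat 1%nat + 2 * c5 h 0%nat 0%nat = (1 - X e h * (1 + D e h)) / 2 /\
      c5 h 0%nat 2%nat + 2 * c5 h 0%nat 1%nat + 3 * c5 h 0%nat 0%nat
        = (1 + X e h * (1 + 2 * D e h) / 2) / 2 /\
      c5 h 1%nat 0%nat = (1 + X e h * (1 + 2 * D e h) / 2) / 2 /\
      c5 h 1%nat 1%nat + 2 * c5 h 1%nat 0%nat = (1 - X e h * (1 + D e h)) / 2)).
    { revert HR. apply filter_imp. intros h (_ & HD & _ & _ & R5).
      pose proof (five_point_coefficients_0 _ _ _ HD (R5 0%nat ltac:(lia))).
      pose proof (five_point_coefficients_1 _ _ _ HD (R5 1%nat ltac:(lia))).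
      tauto. }
    assert (B70 : bounded (at_right 0) (fun h => c7 h 0%nat)).
    { apply bounded_ext with (fun h => (P h - p h) / 2); [exact _ | | bounded].
      revert C7. apply filter_imp. intros h (E0&_). now rewrite E0. }
    assert (B71 : bounded (at_right 0) (fun h => c7 h 1%nat)).
    { apply bounded_ext with (fun h => (Q h - q h) / 2 - 2 * c7 h 0%nat);
        [exact _ | | bounded].
      revert C7. apply filter_imp. intros h (E0&E1&_). lra. }
    assert (B72 : bounded (at_right 0) (fun h => c7 h 2%nat)).
    { apply bounded_ext with
        (fun h => (Q h + q h) / 2 - 2 * c7 h 1%nat - 3 * c7 h 0%nat);
        [exact _ | | bounded].
      revert C7. apply filter_imp. intros h (E0&E1&E2). lra. }
    assert (B00 : bounded (at_right 0) (fun h => c5 h 0%nat 0%nat)).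
    { apply bounded_ext with (fun h => X e h / 4); [exact _ | | bounded].
      revert C5. apply filter_imp. intros h (E0&_). lra. }
    assert (B01 : bounded (at_right 0) (fun h => c5 h 0%nat 1%nat)).
    { apply bounded_ext with
        (fun h => (1 - X e h * (1 + D e h)) / 2 - 2 * c5 h 0%nat 0%nat);
        [exact _ | | bounded].
      revert C5. apply filter_imp. intros h (E0&E1&_). lra. }
    assert (B02 : bounded (at_right 0) (fun h => c5 h 0%nat 2%nat)).
    { apply bounded_ext with (fun h => (1 + X e h * (1 + 2 * D e h) / 2) / 2
          - 2 * c5 h 0%nat 1%nat - 3 * c5 h 0%nat 0%nat); [exact _ | | bounded].
      revert C5. apply filter_imp. intros h (E0&E1&E2&_). lra. }
    assert (B10 : bounded (at_right 0) (fun h => c5 h 1%nat 0%nat)).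
    { apply bounded_ext with (fun h => (1 + X e h * (1 + 2 * D e h) / 2) / 2);
        [exact _ | | bounded].
      revert C5. apply filter_imp. intros h (_&_&_&E0&_). lra. }
    assert (B11 : bounded (at_right 0) (fun h => c5 h 1%nat 1%nat)).
    { apply bounded_ext with
        (fun h => (1 - X e h * (1 + D e h)) / 2 - 2 * c5 h 1%nat 0%nat);
        [exact _ | | bounded].
      revert C5. apply filter_imp. intros h (_&_&_&_&E1). lra. }
    assert (Bdiv : forall m f, (m <= 2)%nat -> bounded (at_right 0) f ->
       bounded (at_right 0) (fun h => f h / c5 h m 0%nat)).
    { intros m f Hm Hf. apply bounded_div with (/ 8); [exact _ | lra | | exact Hf].
      revert Hden. apply filter_imp. intros h (N0&N1&N2&_).
      destruct m as [|[|[|]]]; [assumption .. | lia]. }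
    assert (Bd0 := Bdiv 0%nat _ ltac:(lia) B70).
    assert (Bn1 : bounded (at_right 0) (fun h =>
       c7 h 1%nat - c7 h 0%nat / c5 h 0%nat 0%nat * c5 h 0%nat 1%nat)) by bounded.
    assert (Bd1 := Bdiv 1%nat _ ltac:(lia) Bn1).
    assert (Bn2 : bounded (at_right 0) (fun h =>
       c7 h 2%nat - c7 h 0%nat / c5 h 0%nat 0%nat * c5 h 0%nat 2%nat
       - (c7 h 1%nat - c7 h 0%nat / c5 h 0%nat 0%nat * c5 h 0%nat 1%nat)
         / c5 h 1%nat 0%nat * c5 h 1%nat 1%nat)) by bounded.
    assert (Bd2 := Bdiv 2%nat _ ltac:(lia) Bn2).
    intros [|[|m]]; assumption.
Qed.

(** * Third-order accuracy of the nonlinear weights *)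

(** Dividing zeta = O(h^5) by h^2 gives h^3; the smallness condition of [omega_error] holds
    eventually because the weights are bounded. *)
Lemma omega_order_3 (d : R -> nat -> R) (V : R -> Z -> R) (L : R) (m : nat) :
  (m <= 2)%nat ->
  at_right 0 (fun h => sum_f_R0 (d h) 2 = 1) ->
  (forall j, bounded (at_right 0) (fun h => d h j)) ->
  at_right 0 (fun h => zeta (V h) <= L * h ^ 5) ->
  big_O (at_right 0) (fun h => omega (d h) (V h) h m - d h m) (fun h => h ^ 3).
Proof.
  intros Hm Hsum Hd Hz.
  destruct (Hd 0%nat) as [K0 HK0], (Hd 1%nat) as [K1 HK1], (Hd 2%nat) as [K2 HK2].
  set (K := Rabs K0 + Rabs K1 + Rabs K2).
  assert (HK : at_right 0 (fun h => forall j, (j <= 2)%nat -> Rabs (d h j) <= K)).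
  { generalize (filter_and _ _ HK0 (filter_and _ _ HK1 HK2)). apply filter_imp.
    intros h (H0 & H1 & H2) j Hj. unfold K.
    pose proof (Rle_abs K0). pose proof (Rle_abs K1). pose proof (Rle_abs K2).
    pose proof (Rabs_pos K0). pose proof (Rabs_pos K1). pose proof (Rabs_pos K2).
    destruct j as [|[|[|]]]; [lra .. | lia]. }
  assert (HKpos : 0 <= K) by (unfold K; repeat apply Rplus_le_le_0_compat; apply Rabs_pos).
  assert (Hsmall : at_right 0 (fun h => 0 < h /\ 3 * K * (L * h ^ 3) <= / 2)).
  (* h <= 1/M yields both h <= 1, hence h^3 <= h, and 6 K |L| h <= 1. *)
  { set (M := 6 * K * Rabs L + 1).
    assert (HM : 1 <= M).
    { unfold M. pose proof (Rabs_pos L). assert (0 <= K * Rabs L) by (now apply Rmult_le_pos).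
      lra. }
    assert (Hi : 0 < / M) by (apply Rinv_0_lt_compat; lra).
    exists (mkposreal _ Hi). intros h Hh Hpos. split; auto.
    change (Rabs (h + - 0) < / M) in Hh. rewrite Ropp_0, Rplus_0_r, Rabs_pos_eq in Hh by lra.
    assert (Hh1 : M * h <= 1).
    { replace 1 with (M * / M) by (field; lra). apply Rmult_le_compat_l; lra. }
    assert (h <= 1) by nra. assert (h ^ 3 <= h).
    { replace (h ^ 3) with (h * h * h) by ring. nra. }
    assert (0 <= h ^ 3) by (apply pow_le; lra).
    pose proof (Rle_abs L). pose proof (Rabs_pos L).
    apply Rle_trans with (3 * (K * Rabs L) * h).
    - assert (L * h ^ 3 <= Rabs L * h) by nra. nra.
    - unfold M in Hh1. nra. }
  exists (2 * K * (1 + 3 * K) * L).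
  generalize (filter_and _ _ (filter_and _ _ Hsum HK) (filter_and _ _ Hz Hsmall)).
  apply filter_imp. intros h [[Hs Hb] [Hzh [Hh Hsm]]].
  assert (Hq : zeta (V h) / h ^ 2 <= L * h ^ 3).
  { apply Rle_div_l; [apply pow_lt; auto|].
    now replace (L * h ^ 3 * h ^ 2) with (L * h ^ 5) by ring. }
  apply Rle_trans with (2 * K * (1 + 3 * K) * (zeta (V h) / h ^ 2)).
  - apply omega_error; auto. apply Rle_trans with (2 := Hsm).
    apply Rmult_le_compat_l; [lra | exact Hq].
  - rewrite (Rabs_pos_eq (h ^ 3)) by (apply pow_le; lra).
    rewrite (Rmult_assoc (2 * K * (1 + 3 * K))).
    apply Rmult_le_compat_l; [nra | exact Hq].
Qed.

Theorem theorem4p2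
  (lambda : C) (lambda_neq0 : lambda <> RtoC 0)
  (lambda_real_or_imaginary : Im lambda = 0 \/ Re lambda = 0)
  (g u : R -> R) (xi a b : R)
  (xi_in : a < xi < b)
  (v_smooth : smooth_third_derivative (fun x => g (u x)) a b)
  (c7 : R -> nat -> R) (c5 : R -> nat -> nat -> R)
  (c7_def : at_right 0 (fun h =>
     flux_coefficients (Gamma7 lambda) h (-2) 6 (c7 h)))
  (c5_def : at_right 0 (fun h => forall m : nat, (m <= 2)%nat ->
     flux_coefficients (Gamma5 lambda) h (-2 + Z.of_nat m) 4 (c5 h m))) :
  let v := fun x => g (u x) in
  let d := fun h => ideal_weight (c7 h) (c5 h) in
  forall m : nat, (m <= 2)%nat ->
    big_O (at_right 0) (fun h => omega_plus (d h) v xi h m - d h m)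
          (fun h => h ^ 3) /\
    big_O (at_right 0) (fun h => omega_minus (d h) v xi h m - d h m)
          (fun h => h ^ 3).
Proof.
  intros v d m Hm.
  assert (Hpar : exists e k, k <> 0 /\ lambda = parameter e k).
  { destruct lambda as [l1 l2]. simpl in lambda_real_or_imaginary.
    destruct lambda_real_or_imaginary as [-> | ->].
    - exists true, l1. split; auto. intros ->. now apply lambda_neq0.
    - exists false, l2. split; auto. intros ->. now apply lambda_neq0. }
  destruct Hpar as (e & k & Hk & ->).
  destruct (ideal_weight_asymptotics e k c7 c5 Hk c7_def c5_def) as [Hsum Hd].
  destruct (zeta_order_5 v a b xi xi_in v_smooth) as [L HL].
  split; apply (omega_order_3 d _ L); auto.
  - exact (filter_imp _ _ (fun h H => proj1 H) HL).
  - exact (filter_imp _ _ (fun h H => proj2 H) HL).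
Qed.
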